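(* Let $\Gamma$ be a crystallographic group of rank $2$ which possesses a normal infinite cyclic subgroup, with associated short exact sequence $1 \to A \to \Gamma \xrightarrow{pr} F \to 1$. Let $\mathcal{F}$ be the family of subgroups of $\Gamma$ consisting of all virtually cyclic subgroups of $\Gamma$ and all subgroups $H \leq \Gamma$ which do not surject onto $F$ under $pr$ (i.e. $pr(H) \neq F$). Then, for every finite symmetric generating set $S$ of $\Gamma$, the pair $(\Gamma,S)$ is a Dress--Farrell--Hsiang group of bounded depth with respect to $\mathcal{F}$.
   Context: A group $\Gamma$ is crystallographic if it contains a normal, finitely generated free abelian subgroup $A$ of finite index which equals its own centraliser in $\Gamma$. The subgroup $A$ is unique; the rank of $\Gamma$ is the rank of $A$. Set $F := \Gamma/A$ (a finite group) and let $pr \colon \Gamma \to F$ be the projection. A $G$-simplicial complex is an (abstract) simplicial complex $X$ with a simplicial $G$-action such that whenever $g \in G$ fixes a simplex $\{x_0,\dots,x_n\}$ of $X$ (as a set), then $g x_i = x_i$ for all $i$. Points and metrics of such a complex refer to its geometric realisation; the $\ell^1$-metric is $d^{\ell^1}(\sum_v \lambda_v v, \sum_v \mu_v v) = \sum_v |\lambda_v - \mu_v|$ in barycentric coordinates. A map from the discrete set $G$ to a complex means a map into its geometric realisation. The class $\mathcal{D}r$ (Dress family) consists of the finite groups $D$ for which there are primes $p$ and $q$ and a normal series $P \unlhd H \unlhd D$ such that $P$ is a finite $p$-group, $H/P$ is a finite cyclic group and $D/H$ is a finite $q$-group. The depth $d(Q)$ of a finite group $Q$ is the largest $n$ such that there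 is a chain of subgroups $Q_1 \supsetneq Q_2 \supsetneq \dots \supsetneq Q_n$ in $Q$. Let $G$ be a group, $S$ a finite symmetric generating set of $G$ and $\mathcal{F}$ a family of subgroups of $G$ (closed under conjugation and taking subgroups). $(G,S)$ is a Dress--Farrell--Hsiang group of bounded depth with respect to $\mathcal{F}$ if there exist $N \in \mathbb{N}$ and $B \in \mathbb{N}$ such that for every $\epsilon > 0$ there are (i) an epimorphism $\pi \colon G \twoheadrightarrow Q$ onto a finite group with $d(Q) \leq B$, and (ii) for every subgroup $D \leq Q$ with $D \in \mathcal{D}r$, a $G$-simplicial complex $E_D$ of dimension at most $N$ whose isotropy groups lie in $\mathcal{F}$, and a $\overline{D} := \pi^{-1}(D)$-equivariant map $f_D \colon G \to E_D$ (where $\overline{D}$ acts on $G$ by left multiplication) such that $d^{\ell^1}(f_D(g),f_D(g')) \leq \epsilon$ whenever $g,g' \in G$ satisfy $g^{-1}g' \in S$. A group is virtually cyclic if it contains a cyclic subgroup of finite index (finite groups included). *)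

(* Defs.v *)
From HB Require Import structures.
From mathcomp Require Import all_boot all_order all_algebra all_fingroup.
From mathcomp Require Import all_solvable finmap.
From mathcomp Require Import boolp classical_sets functions cardinality reals.

Set Implicit Arguments.
Unset Strict Implicit.
Unset Printing Implicit Defensive.

Import GRing.Theory Num.Theory.

Local Open Scope classical_set_scope.
Local Open Scope group_scope.

Section Groups.
Variable G : groupType.
Implicit Types (H K C S : set G) (g x y : G).

Definition is_subgroup H : Prop := group_closed [in H].

Definition generated S : set G := smallest is_subgroup S.

Definition is_normal H : Prop := forall h g, H h -> H (h ^ g).

Definition conj_set H g : set G := (fun h => h ^ g) @` H.

Definition centraliser H : set G := [set g | forall h, H h -> commute g h].

Definition left_cosets H K : set (set G) :=
  (fun x => (fun k => x * k) @` K) @` H.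

Definition is_cyclic C : Prop := exists c, C = generated [set c].

Definition virtually_cyclic H : Prop :=
  exists C, [/\ is_subgroup C, C `<=` H, is_cyclic C
              & finite_set (left_cosets H C)].

(* An isomorphism of Z^n, written additively, onto the subgroup A of G. *)
Definition free_abelian_of_rank (A : set G) (n : nat) : Prop :=
  exists f : 'rV[int]_n -> G,
    [/\ forall u v, f (u + v)%R = f u * f v, injective f & range f = A].

(* G is crystallographic of rank n exactly when it has such a subgroup A, and
   then A is unique. *)
Definition crystallographic_subgroup (A : set G) (n : nat) : Prop :=
  [/\ is_subgroup A, is_normal A, free_abelian_of_rank A n,
      finite_set (left_cosets setT A) & centraliser A = A].

Definition symmetric_generating S : Prop :=
  (forall s, S s -> S s^-1) /\ generated S = setT.

Record family := Family {
  in_family :> set G -> Prop;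
  family_subgroup : forall H, in_family H -> is_subgroup H;
  family_conj : forall H g, in_family H -> in_family (conj_set H g);
  family_sub : forall H K, in_family H -> is_subgroup K -> K `<=` H ->
    in_family K
}.

Lemma is_subgroupP H :
  is_subgroup H <-> H 1 /\ (forall x y, H x -> H y -> H (x * y^-1)).
Proof.
split=> -[].
  by move=> /set_mem H1 HD; split=> // x y /mem_set Hx /mem_set Hy;
     apply: set_mem; exact: HD.
move=> H1 HD; split; first exact: mem_set.
by move=> x y /set_mem Hx /set_mem Hy; apply: mem_set; exact: HD.
Qed.

Lemma is_subgroup1 H : is_subgroup H -> H 1.
Proof. by case/is_subgroupP. Qed.

Lemma is_subgroupV H x : is_subgroup H -> H x -> H x^-1.
Proof.
by case/is_subgroupP=> H1 HD /(HD _ _ H1); rewrite mul1g.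
Qed.

Lemma is_subgroupM H x y : is_subgroup H -> H x -> H y -> H (x * y).
Proof.
move=> sH Hx /(is_subgroupV sH) Hy.
by case/is_subgroupP: sH => _ /(_ _ _ Hx Hy); rewrite invgK.
Qed.

Lemma is_subgroupX H x n : is_subgroup H -> H x -> H (x ^+ n).
Proof.
move=> sH Hx; elim: n => [|n IHn]; first exact: is_subgroup1.
by rewrite expgS; exact: is_subgroupM.
Qed.

Lemma is_subgroupI H K : is_subgroup H -> is_subgroup K ->
  is_subgroup (H `&` K).
Proof.
move=> /is_subgroupP[H1 HD] /is_subgroupP[K1 KD]; apply/is_subgroupP.
by split=> // x y [? ?] [? ?]; split; [exact: HD|exact: KD].
Qed.

Lemma is_subgroup_conj H g : is_subgroup H -> is_subgroup (conj_set H g).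
Proof.
move=> /is_subgroupP[H1 HD]; apply/is_subgroupP; split.
  by exists 1 => //; rewrite conj1g.
move=> _ _ [x Hx <-] [y Hy <-]; exists (x * y^-1); first exact: HD.
by rewrite conjMg conjVg.
Qed.

Lemma generated_subgroup S : is_subgroup (generated S).
Proof.
apply/is_subgroupP; split=> [K [/is_subgroup1]//|x y Sx Sy K KS].
by case: (KS) => /is_subgroupP[_ KD] _; apply: KD; [exact: Sx|exact: Sy].
Qed.

Lemma generated_sub H S : is_subgroup H -> S `<=` H -> generated S `<=` H.
Proof. exact: smallest_sub. Qed.

Lemma sub_generated S : S `<=` generated S.
Proof. exact: sub_gen_smallest. Qed.

Lemma cycle_generatedE c x : generated [set c] x ->
  exists n, x = c ^+ n \/ x = c ^- n.
Proof.
move=> cx; suff [n [m ->]] : exists n m, x = c ^+ n * c ^- m.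
  case: (leqP m n) => [lemn|/ltnW lenm].
    by exists (n - m)%N; left; rewrite expgnFr.
  by exists (m - n)%N; right; rewrite expgnFr// invgF.
apply: (cx [set x | exists n m, x = c ^+ n * c ^- m]); split; last first.
  by move=> _ ->; exists 1%N, 0%N; rewrite expg0 invg1 mulg1.
apply/is_subgroupP; split; first by exists 0%N, 0%N; rewrite invg1 mulg1.
move=> _ _ [n [m ->]] [k [l ->]]; exists (n + l)%N, (m + k)%N.
have cE i j : commute (c ^- i) (c ^+ j).
  exact/commute_sym/commuteV/commuteX2.
rewrite invgF !expgnDr invgM -!mulgA; congr (_ * _).
rewrite mulgA cE -!mulgA; congr (_ * _).
by rewrite -!invgM -!expgnDr addnC.
Qed.

Lemma sub_cyclic C K : is_cyclic C -> is_subgroup K -> K `<=` C -> is_cyclic K.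
Proof.
move=> [c ->] sK KC.
have Kpow x : K x -> exists2 n, K (c ^+ n) & x = c ^+ n \/ x = c ^- n.
  move=> Kx; have [n xE] := cycle_generatedE (KC x Kx); exists n => //.
  by case: xE Kx => -> // /(is_subgroupV sK); rewrite invgK.
have [[n0 n0P]|noK] := pselect (exists n, (0 < n)%N && `[< K (c ^+ n) >]).
  have exn : exists n, (0 < n)%N && `[< K (c ^+ n) >] by exists n0.
  case: (ex_minnP exn) => n /andP[n_gt0 /asboolP Kn] nmin.
  exists (c ^+ n); apply/seteqP; split; last first.
    by apply: generated_sub => // _ ->.
  have sN := generated_subgroup [set c ^+ n].
  have Nn : generated [set c ^+ n] (c ^+ n) by exact: sub_generated.
  move=> x /Kpow[k Kk xE].
  have kr : (k %% n = 0)%N.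
    apply/eqP; rewrite -leqn0 leqNgt; apply/negP => r_gt0.
    have Kr : K (c ^+ (k %% n)).
      have -> : c ^+ (k %% n) = (c ^+ n ^+ (k %/ n))^-1 * c ^+ k.
        by rewrite [in c ^+ k](divn_eq k n) expgnDr mulnC expgnA mulKg.
      apply: is_subgroupM => //; apply: is_subgroupV => //.
      exact: is_subgroupX.
    have := nmin (k %% n)%N; rewrite r_gt0/= => /(_ (asboolT Kr)).
    by rewrite leqNgt ltn_pmod.
  have Nk : generated [set c ^+ n] (c ^+ k).
    by rewrite (divn_eq k n) kr addn0 mulnC expgnA; exact: (is_subgroupX _ sN).
  by case: xE => ->//; exact: (is_subgroupV sN).
exists 1; apply/seteqP; split; last first.
  by apply: generated_sub => // _ ->; exact: (is_subgroup1 sK).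
move=> x /Kpow[k Kk xE].
suff -> : x = 1 by exact: is_subgroup1 (generated_subgroup _).
case: k Kk xE => [|k] Kk xE; first by case: xE => ->; rewrite ?invg1.
by case: noK; exists k.+1; apply/asboolP.
Qed.

Lemma conj_cyclic C g : is_cyclic C -> is_cyclic (conj_set C g).
Proof.
move=> [c ->]; exists (c ^ g); apply/seteqP; split.
  move=> _ [x cx <-].
  have sN := generated_subgroup [set c ^ g].
  have Nc : generated [set c ^ g] (c ^ g) by exact: sub_generated.
  have [n [] ->] := cycle_generatedE cx.
    by rewrite conjXg; exact: (is_subgroupX _ sN).
  by rewrite conjVg conjXg; apply: (is_subgroupV sN); exact: (is_subgroupX _ sN).
apply: generated_sub; first exact/is_subgroup_conj/generated_subgroup.
by move=> _ ->; exists c => //; exact: sub_generated.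
Qed.

Lemma conj_virtually_cyclic H g :
  virtually_cyclic H -> virtually_cyclic (conj_set H g).
Proof.
move=> [C [sC CH cC fC]]; exists (conj_set C g); split.
- exact: is_subgroup_conj.
- exact: image_subset.
- exact: conj_cyclic.
apply: (sub_finite_set _ (finite_image (fun T => conj_set T g) fC)).
move=> _ [_ [x Hx <-] <-].
exists ((fun k => x * k) @` C); first by exists x.
apply/seteqP; split.
  move=> _ [_ [k Ck <-] <-]; exists (k ^ g); first by exists k.
  by rewrite conjMg.
move=> _ [_ [k Ck <-] <-]; exists (x * k); first by exists k.
by rewrite conjMg.
Qed.

Lemma sub_virtually_cyclic H K : virtually_cyclic H -> is_subgroup K ->
  K `<=` H -> virtually_cyclic K.
Proof.
move=> [C [sC CH cC fC]] sK KH; exists (C `&` K); split.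
- exact: is_subgroupI.
- by move=> x [].
- by apply: sub_cyclic cC _ _; [exact: is_subgroupI|move=> x []].
apply: (sub_finite_set _ (finite_image (fun T => T `&` K) fC)).
move=> _ [x Kx <-].
exists ((fun k => x * k) @` C); first by exists x => //; exact: KH.
apply/seteqP; split.
  move=> _ [[k Ck <-] Kxk]; exists k => //; split=> //.
  by rewrite -(mulKg x k); apply: is_subgroupM => //; exact: is_subgroupV.
move=> _ [k [Ck Kk] <-]; split; first by exists k.
exact: is_subgroupM.
Qed.

End Groups.

Section VcycOrNonsurjective.
Variables (G : groupType) (F : finGroupType) (pr : {multiplicative G -> F}).

Definition vcyc_or_nonsurj : set (set G) :=
  [set H | is_subgroup H /\ (virtually_cyclic H \/ pr @` H <> setT)].

Lemma vcyc_or_nonsurj_subgroup H : vcyc_or_nonsurj H -> is_subgroup H.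
Proof. by case. Qed.

Lemma vcyc_or_nonsurj_conj H g :
  vcyc_or_nonsurj H -> vcyc_or_nonsurj (conj_set H g).
Proof.
move=> [sH vnH]; split; first exact: is_subgroup_conj.
case: vnH => [vH|nH]; [left; exact: conj_virtually_cyclic|right=> HgT].
apply: nH; apply/seteqP; split=> // y _.
have : (pr @` conj_set H g) (y ^ pr g) by rewrite HgT.
move=> [_ [h Hh <-] hE]; exists h => //; move: hE.
rewrite /conjg !gmulfM.
have prV : pr g^-1 = (pr g)^-1.
  apply/esym/mulg1_eq; rewrite -gmulfM mulgV.
  by apply: (@mulgI _ (pr 1)); rewrite -gmulfM !mulg1.
by rewrite prV => /mulgI/mulIg.
Qed.

Lemma vcyc_or_nonsurj_sub H K :
  vcyc_or_nonsurj H -> is_subgroup K -> K `<=` H -> vcyc_or_nonsurj K.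
Proof.
move=> [sH vnH] sK KH; split=> //.
case: vnH => [vH|nH]; [left; exact: sub_virtually_cyclic vH _ _|right=> KT].
apply: nH; apply/seteqP; split=> // y _.
have [x /KH Hx <-] : (pr @` K) y by rewrite KT.
by exists x.
Qed.

Definition vcyc_or_nonsurj_family : family G :=
  Family vcyc_or_nonsurj_subgroup vcyc_or_nonsurj_conj vcyc_or_nonsurj_sub.

End VcycOrNonsurjective.

Section FiniteGroups.
Variable Q : finGroupType.

Definition subgroup_chain (s : seq {group Q}) : bool :=
  sorted (fun H K : {group Q} => K \proper H) s.

(* The orders along a chain are distinct and lie in [1, #|Q|], so that
   restricting the length n to n <= #|Q| loses nothing: see leq_depth. *)
Definition depth : nat :=
  \max_(n < #|Q|.+1 | [exists s : n.-tuple {group Q}, subgroup_chain s]) n.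

Lemma leq_depth (s : seq {group Q}) : subgroup_chain s -> size s <= depth.
Proof.
move=> chs; have szs : size s < #|Q|.+1.
  have ps : forall (H : {group Q}) t,
      path (fun H K : {group Q} => K \proper H) H t -> size t < #|H|.
    move=> H t; elim: t H => [|K t IHt] H /=; first by rewrite cardG_gt0.
    by move=> /andP[/proper_card KH /IHt tK]; exact: leq_ltn_trans tK KH.
  case: s chs => //= H t /ps ltH; rewrite ltnS; apply: leq_trans ltH _.
  exact: max_card.
apply: (leq_bigmax_cond (Ordinal szs)).
by apply/existsP; exists (in_tuple s).
Qed.

Definition dress (D : {group Q}) : Prop :=
  exists p q (P H : {group Q}), [/\ prime p /\ prime q, P <| H /\ H <| D,
    p.-group P, cyclic (H / P) & q.-group (D / H)].

End FiniteGroups.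

Local Open Scope fset_scope.

(* The type V is the vertex set, hence simplex1. *)
Record simplicial_complex (V : choiceType) := SimplicialComplex {
  simplex :> {fset V} -> Prop;
  simplex_neq0 : forall s, simplex s -> s != fset0;
  simplex1 : forall v, simplex [fset v];
  simplex_sub : forall s t, simplex s -> t `<=` s -> t != fset0 -> simplex t
}.

Record gcomplex (G : groupType) := GComplex {
  vertex : choiceType;
  complex :> simplicial_complex vertex;
  act : G -> vertex -> vertex;
  act1 : forall v, act 1%g v = v;
  actM : forall g h v, act (g * h)%g v = act g (act h v);
  act_simplex : forall g s, complex s -> complex [fset act g v | v in s];
  act_fix : forall g s, complex s -> [fset act g v | v in s] = s ->
    {in s, forall v, act g v = v}
}.

Section Realisation.
Variables (R : realType) (G : groupType) (E : gcomplex G).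
Local Open Scope ring_scope.

(* Finitely supported barycentric coordinates; only the elements of
   realisation below are points of E. *)
Definition coords := {fsfun vertex E -> R with 0}.

Definition realisation : set coords :=
  [set x : coords | [/\ complex E (finsupp x), forall v, 0 <= x v
                     & \sum_(v <- finsupp x) x v = 1]].

Definition l1_dist (x y : coords) : R :=
  \sum_(v <- finsupp x `|` finsupp y) `|x v - y v|.

Definition act_coords (g : G) (x : coords) : coords :=
  [fsfun v in [fset act g w | w in finsupp x] => x (act g^-1%g v) | 0].

Lemma act_coordsE g x v : act_coords g x v = x (act g^-1%g v).
Proof.
rewrite fsfunE; case: ifPn => // vNgx; apply/esym/fsfun_dflt.
apply: contra vNgx => gv; apply/imfsetP; exists (act g^-1%g v) => //.
by rewrite -actM mulgV act1.
Qed.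

Definition isotropy (x : coords) : set G := [set g | act_coords g x = x].

Definition dim_le (N : nat) : Prop :=
  forall s, complex E s -> (#|` s| <= N.+1)%N.

End Realisation.

Definition dress_farrell_hsiang (R : realType) (G : groupType) (S : set G)
    (Fam : family G) : Prop :=
  exists N B : nat, forall eps : R, (0 < eps)%R ->
  exists (Q : finGroupType) (pi : {multiplicative G -> Q}),
    [/\ range pi = setT, (depth Q <= B)%N
      & forall D : {group Q}, dress D ->
        exists (E : gcomplex G) (f : G -> coords R E),
          [/\ dim_le E N,
              forall x : coords R E, realisation x -> Fam (isotropy x),
              forall g, realisation (f g),
              forall d g, pi d \in D -> f (d * g)%g = act_coords d (f g)
            & forall g g', S (g^-1 * g')%g ->
                (l1_dist (f g) (f g') <= eps)%R]].

(* Main.v *)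
Require Import Defs.
From HB Require Import structures.
From mathcomp Require Import all_boot all_order all_algebra all_fingroup.
From mathcomp Require Import all_solvable finmap zify ring lra.
From mathcomp Require Import boolp classical_sets cardinality reals.

(** The group Gamma acts by conjugation on its lattice A, which is Z^2, through
the finite group F.  A generator of the normal infinite cyclic subgroup has a
power in A, so that F preserves a line Z u of the lattice up to sign.  Hence
there are two linear functionals on Z^2 that are nonzero and F-equivariant up to
signs chi1 and chi2: the determinant against u, and an average over F of the
scalar product with u.  Together they separate the points of Z^2
([eigen_functionals]).

A functional phi on which F acts by a sign character chi extends to an action of
Gamma on the integers, v |-> chi(g) v + c(g), in which a in A translates by
2 |F| phi(a); the cocycle c is obtained by averaging phi over F
([cocycleM], [cocycle_ker]).  Joining v to v + r for an odd number r gives a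
Gamma-graph E, a disjoint union of r lines.  As c is even and r is odd, no edge
is inverted.  The stabiliser of a vertex meets A in the kernel of phi, so that it
is virtually cyclic.  Map g to the point of position c(g) on one line v0 + r Z,
whose edges have length r: neighbours in Gamma are sent to points at distance
O(|phi| / r) ([line_point_dist]), and the map is equivariant for the subgroups
that preserve this line.  A subgroup K that surjects onto F preserves such a line
as soon as phi vanishes modulo r on the intersection of K and A, because F then
acts on Z/r by affine maps and the average of an orbit is a fixed point
([invariant_progression]).

The finite quotients are Q = Gamma / nA for n = r1 r2 r3 a product of three
distinct large primes.  Their orders are products of a fixed number of primes,
which bounds the depth ([depth_bound]).  Let D be a Dress subgroup of Q for the
primes p and q, and K its preimage.  If K does not surject onto F, a constant map
to a discrete Gamma-set will do ([nonsurj_contracting_map]).  Otherwise let r be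
one of the three primes other than p and q.  The r-subgroups of D are cyclic
([dress_cyclic]), so that the intersection of K and A is, modulo r, the line of
multiples of one vector w ([dress_preimage_line]).  If F acts on the lattice by
the signs chi1 = chi2, then every functional is equivariant, and by the pigeonhole
principle some functional of size at most sqrt r vanishes on w modulo r ([thue]).
If not, K contains an element whose signs under chi1 and chi2 differ; as it maps
the line of w to itself, one of the two eigenfunctionals, which are independent
of r, vanishes on w modulo r ([dress_line_functional]).  Either way
|phi| / r tends to 0 as r grows. *)

Set Implicit Arguments.
Unset Strict Implicit.
Unset Printing Implicit Defensive.

Import Order.TTheory GRing.Theory Num.Theory.

Local Open Scope classical_set_scope.
Local Open Scope ring_scope.

(** * Multiplicative maps, isotropy groups, and the action on a line *)

Section MorphismBasics.
Variables (G H : groupType) (f : {multiplicative G -> H}).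

Lemma multiplicative1 : f 1%g = 1%g.
Proof. by apply: (@mulgI _ (f 1%g)); rewrite -gmulfM !mulg1. Qed.

Lemma multiplicativeV x : f x^-1%g = (f x)^-1%g.
Proof.
by apply/esym/mulg1_eq; rewrite -gmulfM mulgV multiplicative1.
Qed.

Lemma multiplicativeX n x : f (x ^+ n)%g = (f x ^+ n)%g.
Proof.
elim: n => [|n IH]; first by rewrite !expg0 multiplicative1.
by rewrite !expgS gmulfM IH.
Qed.

End MorphismBasics.

Section RealisationFacts.
Variables (R : realType) (G : groupType) (E : gcomplex G).
Implicit Type x : coords R E.

Lemma act_coords1 x : act_coords 1%g x = x.
Proof. by apply/fsfunP => v; rewrite act_coordsE invg1 Defs.act1. Qed.

Lemma act_coordsM g h x :
  act_coords (g * h)%g x = act_coords g (act_coords h x).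
Proof. by apply/fsfunP => v; rewrite !act_coordsE invgM Defs.actM. Qed.

Lemma isotropy_subgroup x : is_subgroup (isotropy x).
Proof.
apply/is_subgroupP; split=> [|g h /= xg xh]; first exact: act_coords1.
by rewrite /isotropy /= -{1}xh -act_coordsM mulgVK.
Qed.

(** An element that fixes a point permutes its support, which is a simplex, and an
element that preserves a simplex fixes its vertices. *)
Lemma isotropy_vertex x g : realisation x -> isotropy x g ->
  {in finsupp x, forall v, @Defs.act G E g v = v}.
Proof.
move=> [Ex _ _] xg; apply: (act_fix Ex); apply/fsetP => v.
have suppE w : (@Defs.act G E g w \in finsupp x) = (w \in finsupp x).
  by rewrite !mem_finsupp -{1}xg act_coordsE -Defs.actM mulVg Defs.act1.
apply/imfsetP/idP => [[w /= xw ->]|xv]; first by rewrite suppE.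
exists (@Defs.act G E g^-1%g v); last by rewrite -Defs.actM mulgV Defs.act1.
by rewrite /= -suppE -Defs.actM mulgV Defs.act1.
Qed.

(** Reduces the condition on isotropy groups of points, here and below, to
stabilisers of vertices, since families are closed under subgroups. *)
Lemma isotropy_in_family (Fam : Defs.family G) x : realisation x ->
  (forall v, Fam [set g | @Defs.act G E g v = v]) -> Fam (isotropy x).
Proof.
move=> rx FamE; have [Ex _ _] := rx.
have /fset0Pn[v xv] := simplex_neq0 Ex.
apply: family_sub (FamE v) (isotropy_subgroup x) _ => g xg /=.
exact: isotropy_vertex rx xg v xv.
Qed.

End RealisationFacts.

(** The data required of a Dress subgroup, with an arbitrary subset [K] of the
group in place of the preimage of that subgroup. *)
Definition contracting_map (R : realType) (G : groupType) (S : set G)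
    (Fam : Defs.family G) (N : nat) (K : set G) (eps : R) : Prop :=
  exists (E : gcomplex G) (f : G -> coords R E),
    [/\ dim_le E N,
        forall x : coords R E, realisation x -> Fam (isotropy x),
        forall g, realisation (f g),
        forall d g, K d -> f (d * g)%g = act_coords d (f g)
      & forall g g', S (g^-1 * g')%g -> l1_dist (f g) (f g') <= eps].

Lemma int_sqr_eq1 (x : int) : x * x = 1 -> x = 1 \/ x = -1.
Proof. by nia. Qed.

(** An action on the integers through a sign [chi] and a [chi]-twisted cocycle
[c], and the graph that joins each [v] to [v + r]. *)
Section LineComplex.
Variables (G : groupType) (chi c : G -> int) (r : nat).
Hypothesis chi_sq : forall g, chi g * chi g = 1.
Hypothesis chiM : forall g h, chi (g * h)%g = chi g * chi h.
Hypothesis cM : forall g h, c (g * h)%g = c g + chi g * c h.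
Hypothesis c_even : forall g, exists m : int, c g = 2 * m.
Hypothesis r_odd : odd r.

Definition line_act (g : G) (v : int) : int := chi g * v + c g.

Lemma line_act1 v : line_act 1%g v = v.
Proof.
have chi1 : chi 1%g = 1 by rewrite -(chi_sq 1%g) -chiM mulg1.
have : c 1%g = c 1%g + chi 1%g * c 1%g by rewrite -cM mulg1.
rewrite chi1 mul1r => /eqP; rewrite -subr_eq0 opprD addrA subrr sub0r oppr_eq0.
by move=> /eqP c1; rewrite /line_act chi1 c1 mul1r addr0.
Qed.

Lemma line_actM g h v : line_act (g * h)%g v = line_act g (line_act h v).
Proof. by rewrite /line_act chiM cM; ring. Qed.

Lemma line_stabiliser_subgroup v : is_subgroup [set g | line_act g v = v].
Proof.
apply/is_subgroupP; split=> [|g h /= gv hv]; first exact: line_act1.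
by rewrite -{1}hv -line_actM mulgVK.
Qed.

Lemma chi_pm1 g : chi g = 1 \/ chi g = -1.
Proof. exact: int_sqr_eq1. Qed.

Lemma chi_norm g : `|chi g| = 1 :> int.
Proof. by have [->|->] := chi_pm1 g. Qed.

Lemma line_act_dist g v w : `|line_act g v - line_act g w| = `|v - w|.
Proof.
have -> : line_act g v - line_act g w = chi g * (v - w).
  by rewrite /line_act; ring.
by rewrite normrM chi_norm mul1r.
Qed.

Definition edge (v : int) : {fset int} := [fset v; (v + r%:Z)%R]%fset.

Lemma edgeP w v : reflect (w = v \/ w = v + r%:Z) (w \in edge v).
Proof. exact: fset2P. Qed.

Definition line_simplex (s : {fset int}) : Prop :=
  s != fset0%fset /\ exists v : int, (s `<=` edge v)%fset.

Lemma line_simplex_neq0 s : line_simplex s -> s != fset0%fset.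
Proof. by case. Qed.

Lemma line_simplex1 v : line_simplex [fset v]%fset.
Proof.
split; first by apply/fset0Pn; exists v; rewrite in_fset1.
by exists v; rewrite fsub1set; apply/edgeP; left.
Qed.

Lemma line_simplex_sub s t :
  line_simplex s -> (t `<=` s)%fset -> t != fset0%fset -> line_simplex t.
Proof.
by move=> [_ [v sv]] ts t0; split=> //; exists v; exact: fsubset_trans sv.
Qed.

Definition line_complex : simplicial_complex int :=
  SimplicialComplex line_simplex_neq0 line_simplex1 line_simplex_sub.

Lemma line_act_simplex g s :
  line_complex s -> line_complex [fset line_act g v | v in s]%fset.
Proof.
move=> [/fset0Pn[w sw] [v sv]]; split.
  by apply/fset0Pn; exists (line_act g w); apply: in_imfset.
have [chi1|chi1] := chi_pm1 g.
  exists (line_act g v); apply/fsubsetP => _ /imfsetP[u /= /(fsubsetP sv) + ->].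
  by rewrite /line_act chi1 => /edgeP[] ->; apply/edgeP; [left|right]; lia.
exists (line_act g (v + r%:Z)).
apply/fsubsetP => _ /imfsetP[u /= /(fsubsetP sv) + ->].
by rewrite /line_act chi1 => /edgeP[] ->; apply/edgeP; [right|left]; lia.
Qed.

(** An element that inverts the edge from [v] to [v + r] would be a reflection
with [c g = 2 v + r], which is odd. *)
Lemma line_act_fix g s : line_complex s -> [fset line_act g v | v in s]%fset = s ->
  {in s, forall v, line_act g v = v}.
Proof.
move=> [_ [v sv]] gs.
have gP w : w \in s -> line_act g w \in s.
  by move=> sw; rewrite -[in X in _ \in X]gs; apply: in_imfset.
have sP w : w \in s -> w = v \/ w = v + r%:Z.
  by move=> /(fsubsetP sv)/edgeP.
have [m cE] := c_even g; have rE := odd_double_half r.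
move=> w sw; have sgw := gP _ sw; have sggw := gP _ sgw.
have := sP _ sw; have := sP _ sgw; have := sP _ sggw.
have [chi1|chi1] := chi_pm1 g.
all: by rewrite /line_act chi1 cE; rewrite r_odd in rE; lia.
Qed.

Definition line_gcomplex : gcomplex G :=
  GComplex line_act1 line_actM line_act_simplex line_act_fix.

Lemma line_dim : dim_le line_gcomplex 1.
Proof.
move=> s [_ [v /fsubset_leq_card]]; rewrite cardfs2 => /leq_trans; apply.
by case: (_ != _).
Qed.

Section LinePoint.
Variables (R : realType) (v0 : int).

Let r_gt0 : (0 < r)%N. Proof. by case: r r_odd. Qed.
Let rR_gt0 : 0 < r%:R :> R. Proof. by rewrite ltr0n. Qed.

(** The barycentric coordinates of the point at position [z] on the line through
[v0], as a function of the vertex: writing them as a tent of width [r] makes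
equivariance and the Lipschitz estimate visible. *)
Definition hat (z v : int) : R :=
  if (r%:Z %| v - v0)%Z then Num.max 0 (1 - `|z - v|%:~R / r%:R) else 0.

(** The left end of the edge of the line [v0 + r Z] that contains position [z]. *)
Definition cell (z : int) : int := v0 + ((z - v0) %/ r%:Z)%Z * r%:Z.

Definition line_point (z : int) : coords R line_gcomplex :=
  [fsfun v in edge (cell z) => hat z v | 0].

Lemma cellP z : exists2 j : nat, (j < r)%N & z = cell z + j%:Z.
Proof.
have r0 : r%:Z != 0 by lia.
exists `|((z - v0) %% r%:Z)%Z|%N.
  have := ltz_pmod (z - v0) (_ : 0 < r%:Z); have := modz_ge0 (z - v0) r0; lia.
rewrite /cell gez0_abs ?modz_ge0 // -addrA -divz_eq; lia.
Qed.

Lemma hat_cell z v : hat z v != 0 -> v = cell z \/ v = cell z + r%:Z.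
Proof.
rewrite /hat; case: ifP => [/dvdzP[k vE]|]; last by rewrite eqxx.
have [lt_r _|le_r] := ltP `|z - v| r%:Z; last first.
  rewrite max_l ?eqxx // subr_le0 ler_pdivlMr // mul1r.
  by rewrite pmulrn ler_int.
have [j lt_j zE] := cellP z; move: zE lt_r.
rewrite /cell; set q := ((z - v0) %/ r%:Z)%Z => zE lt_r.
have : k = q \/ k = q + 1 by nia.
by case=> kE; [left|right]; rewrite -[v](subrK v0) vE kE; ring.
Qed.

Lemma line_pointE z v : line_point z v = hat z v.
Proof.
rewrite fsfunE; case: ifPn => // /edgeP nv.
by apply/esym/eqP; apply: contra_notT nv; exact: hat_cell.
Qed.

Lemma finsupp_line_point z :
  (finsupp (line_point z) `<=` edge (cell z))%fset.
Proof.
by apply/fsubsetP => v; rewrite mem_finsupp line_pointE => /hat_cell/edgeP.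
Qed.

Lemma line_point_realisation z : realisation (line_point z).
Proof.
have sum1 : \sum_(v <- finsupp (line_point z)) line_point z v = 1.
  rewrite (@big_fset_incl _ _ _ _ _ _ _ (finsupp_line_point z)); last first.
    by move=> v _; exact: fsfun_dflt.
  have nr : cell z \notin [fset (cell z + r%:Z)%R]%fset by rewrite in_fset1; lia.
  rewrite big_fsetU1 //= big_seq_fset1 !line_pointE /hat.
  have [j lt_j zE] := cellP z.
  have -> : (r%:Z %| cell z - v0)%Z.
    by rewrite /cell addrC addKr dvdz_mull.
  have -> : (r%:Z %| cell z + r%:Z - v0)%Z.
    rewrite (_ : _ - _ = (((z - v0) %/ r%:Z)%Z + 1) * r%:Z) ?dvdz_mull //.
    by rewrite /cell; ring.
  have -> : `|z - cell z| = j%:Z by lia.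
  have -> : `|z - (cell z + r%:Z)| = r%:Z - j%:Z by lia.
  rewrite rmorphB /= -!pmulrn.
  have jr : j%:R / r%:R <= 1 :> R.
    by rewrite ler_pdivrMr // mul1r ler_nat ltnW.
  have j0 : 0 <= j%:R / r%:R :> R by rewrite divr_ge0.
  have -> : (r%:R - j%:R) / r%:R = 1 - j%:R / r%:R :> R.
    by rewrite mulrBl divff // gt_eqF.
  by rewrite !max_r; lra.
split=> //.
- split; last by exists (cell z); exact: finsupp_line_point.
  apply/eqP => s0; move: sum1; rewrite s0 big_seq_fset0 => /eqP.
  by rewrite eq_sym oner_eq0.
- by move=> v; rewrite line_pointE /hat; case: ifP => // _; rewrite le_max lexx.
Qed.

Lemma hat_lipschitz z z' v : `|hat z v - hat z' v| <= `|z - z'|%:~R / r%:R.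
Proof.
have d0 (w : int) : 0 <= `|w|%:~R / r%:R :> R.
  by rewrite divr_ge0 // ler0z.
rewrite /hat; case: ifP => _; last by rewrite subrr normr0.
have tri (a b : int) : `|a|%:~R / r%:R <= `|b|%:~R / r%:R + `|a - b|%:~R / r%:R :> R.
  rewrite -mulrDl ler_pM2r ?invr_gt0 // -rmorphD /= ler_int; lia.
have t1 := tri (z - v) (z' - v); have t2 := tri (z' - v) (z - v).
have e1 : `|z - v - (z' - v)| = `|z - z'| by lia.
have e2 : `|z' - v - (z - v)| = `|z - z'| by lia.
rewrite {}e1 in t1; rewrite {}e2 in t2.
have := d0 (z - v); have := d0 (z' - v); have := d0 (z - z').
move: t1 t2; set a := _ / _; set b := _ / _; set e := _ / _ => *.
by rewrite ler_norml !maxEle; do 2 case: ifP => ?; apply/andP; split; lra.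
Qed.

(** Only the at most four end points of the two edges contribute, each by at most
the Lipschitz bound of the tents. *)
Lemma line_point_dist z z' :
  l1_dist (line_point z) (line_point z') <= `|z - z'|%:~R / r%:R *+ 4.
Proof.
rewrite /l1_dist big_seq_fsetE /=.
apply: le_trans (ler_sum _ (fun v _ => _ : _ <= `|z - z'|%:~R / r%:R)) _.
  by move=> v; rewrite !line_pointE hat_lipschitz.
rewrite sumr_const; apply: ler_wpMn2l; first by rewrite divr_ge0 // ler0z.
rewrite -cardfE; have ce w : (#|` edge w| <= 2)%N.
  by rewrite /edge cardfs2; case: (_ != _).
have fs w := leq_trans (fsubset_leq_card (finsupp_line_point w)) (ce _).
by rewrite cardfsU (leq_trans (leq_subr _ _)) // (leq_add (fs z) (fs z')).
Qed.

Lemma line_point_equivariant g z :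
  (r%:Z %| line_act g v0 - v0)%Z ->
  line_point (line_act g z) = act_coords g (line_point z).
Proof.
move=> gv0; apply/fsfunP => v; rewrite act_coordsE !line_pointE /hat /=.
set w := line_act g^-1%g v.
have vE : v = line_act g w by rewrite /w -line_actM mulgV line_act1.
have -> : (r%:Z %| v - v0)%Z = (r%:Z %| w - v0)%Z.
  have -> : v - v0 = chi g * (w - v0) + (line_act g v0 - v0).
    by rewrite vE /line_act; ring.
  rewrite [LHS]rpredDr //.
  have [->|->] := chi_pm1 g.
    by rewrite mul1r.
  by rewrite mulN1r [LHS]rpredN.
by rewrite vE line_act_dist.
Qed.

(** The map sends [g] to position [c g], which is the orbit of the position 0 under
the affine action; the line that carries these positions is chosen so that it is
preserved by [K]. *)
Lemma line_contracting_map (Fam : Defs.family G) (S K : set G) (eps : R) :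
  (forall v, Fam [set g | line_act g v = v]) ->
  (forall d, K d -> (r%:Z %| line_act d v0 - v0)%Z) ->
  (forall s, S s -> `|c s|%:~R / r%:R *+ 4 <= eps) ->
  contracting_map S Fam 1 K eps.
Proof.
move=> FamE Kv0 Seps; exists line_gcomplex, (fun g => line_point (c g)); split.
- exact: line_dim.
- by move=> x rx; exact: isotropy_in_family.
- by move=> g; exact: line_point_realisation.
- move=> d g Kd; rewrite -line_point_equivariant; last exact: Kv0.
  by rewrite /line_act cM addrC.
move=> g g' Sg; apply: le_trans (line_point_dist _ _) _.
rewrite (_ : `|c g - c g'| = `|c (g^-1 * g')%g|); first exact: Seps.
rewrite -[g' in LHS](mulKVg g) cM opprD addNKr normrN.
by rewrite normrM chi_norm mul1r.
Qed.

End LinePoint.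
End LineComplex.

(** * Subgroups that do not surject onto the point group *)

Section DiscreteComplex.
Variables (G : groupType) (V : choiceType) (a : G -> V -> V).
Hypothesis a1 : forall v, a 1%g v = v.
Hypothesis aM : forall g h v, a (g * h)%g v = a g (a h v).

Definition singleton (s : {fset V}) : Prop := exists v, s = [fset v]%fset.

Lemma singleton_neq0 s : singleton s -> s != fset0%fset.
Proof. by case=> v ->; apply/fset0Pn; exists v; rewrite in_fset1. Qed.

Lemma singleton1 v : singleton [fset v]%fset.
Proof. by exists v. Qed.

Lemma singleton_sub s t :
  singleton s -> (t `<=` s)%fset -> t != fset0%fset -> singleton t.
Proof.
move=> [v ->]; rewrite fsubset1 => /orP[/eqP->|/eqP->]; last by rewrite eqxx.
by exists v.
Qed.

Definition discrete_complex : simplicial_complex V :=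
  SimplicialComplex singleton_neq0 singleton1 singleton_sub.

Lemma image_singleton g v : ([fset a g w | w in [fset v]] = [fset a g v])%fset.
Proof.
apply/fsetP => u; rewrite in_fset1; apply/imfsetP/eqP => [[w /= + ->]|->].
  by rewrite in_fset1 => /eqP->.
by exists v => //=; rewrite in_fset1.
Qed.

Lemma discrete_simplex g s :
  discrete_complex s -> discrete_complex [fset a g v | v in s]%fset.
Proof. by move=> [v ->]; exists (a g v); rewrite image_singleton. Qed.

Lemma discrete_fix g s : discrete_complex s -> [fset a g v | v in s]%fset = s ->
  {in s, forall v, a g v = v}.
Proof.
move=> [v ->]; rewrite image_singleton => /fset1_inj av w.
by rewrite in_fset1 => /eqP->.
Qed.

Definition discrete_gcomplex : gcomplex G :=
  GComplex a1 aM discrete_simplex discrete_fix.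

Lemma discrete_dim : dim_le discrete_gcomplex 1.
Proof. by move=> s [v ->]; rewrite cardfs1. Qed.

(** A constant map contracts every distance; it is equivariant for whatever fixes
its value. *)
Lemma fixed_vertex_contracting_map (R : realType) (Fam : Defs.family G)
    (S K : set G) (eps : R) (v0 : V) : 0 < eps ->
  (forall v, Fam [set g | a g v = v]) -> (forall d, K d -> a d v0 = v0) ->
  contracting_map S Fam 1 K eps.
Proof.
move=> eps0 FamE Kv0.
pose x : coords R discrete_gcomplex :=
  [fsfun v in [fset v0]%fset => (1 : R) | 0].
have xE v : x v = if v == v0 then 1 else 0 by rewrite fsfunE in_fset1.
have sx : finsupp x = [fset v0]%fset.
  apply/fsetP => v; rewrite mem_finsupp xE in_fset1.
  by case: ifP => _; rewrite ?oner_eq0 ?eqxx.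
exists discrete_gcomplex, (fun=> x); split.
- exact: discrete_dim.
- by move=> y ry; exact: isotropy_in_family.
- move=> _; split; first by rewrite sx; exists v0.
    by move=> v; rewrite xE; case: ifP.
  by rewrite sx big_seq_fset1 xE eqxx.
- move=> d _ /Kv0 dv0; apply/fsfunP => v; rewrite act_coordsE !xE /=.
  suff -> : (a d^-1%g v == v0) = (v == v0) by [].
  apply/idP/idP => /eqP => [vE|->]; last by rewrite -{1}dv0 -aM mulVg a1.
  by rewrite -dv0 -vE -aM mulgV a1.
move=> g g' _; rewrite /l1_dist big1 ?ltW // => v _.
by rewrite subrr normr0.
Qed.

End DiscreteComplex.

Section NonSurjective.
Variables (G : groupType) (F : finGroupType) (pr : {multiplicative G -> F}).

(** Left translation acts on these subsets with proper stabilisers, because only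
the empty set and the whole group are invariant under all translations.  They
serve as a substitute for the cosets of one subgroup. *)
Definition proper_nonempty (T : {set F}) : bool := (0 < #|T| < #|F|)%N.

Lemma proper_nonempty_translate g (T : {T : {set F} | proper_nonempty T}) :
  proper_nonempty (pr g *: val T)%g.
Proof.
by rewrite /proper_nonempty card_lcoset; exact: (valP T).
Qed.

Definition translate g (T : {T : {set F} | proper_nonempty T}) :
    {T : {set F} | proper_nonempty T} :=
  Sub (pr g *: val T)%g (proper_nonempty_translate g T).

Lemma translate1 T : translate 1%g T = T.
Proof. by apply: val_inj; rewrite /= multiplicative1 lcoset1. Qed.

Lemma translateM g h T : translate (g * h)%g T = translate g (translate h T).
Proof. by apply: val_inj; rewrite /= gmulfM lcosetM. Qed.

Lemma stabiliser_nonsurj T :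
  vcyc_or_nonsurj pr [set g | translate g T = T].
Proof.
split.
  apply/is_subgroupP; split=> [|g h /= gT hT]; first exact: translate1.
  by rewrite -{1}hT -translateM mulgVK.
right=> prT; have /andP[/card_gt0P[x xT] ltT] := valP T.
have [y] : exists y, y \notin val T.
  apply/existsP; rewrite -negb_forall; apply: contraL ltT => /forallP TF.
  by rewrite -leqNgt subset_leq_card //; apply/fintype.subsetP => y _; exact: TF.
move/negP; apply.
have [g gT gE] : (pr @` [set g | translate g T = T]) (y * x^-1)%g by rewrite prT.
by rewrite -gT /= mem_lcoset gE invgM invgK mulgVK.
Qed.

(** The image of [K] is itself a proper nonempty subset that [K] preserves. *)
Lemma nonsurj_contracting_map (R : realType) (S K : set G) (eps : R) :
  0 < eps -> is_subgroup K -> pr @` K <> setT ->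
  contracting_map S (vcyc_or_nonsurj_family pr) 1 K eps.
Proof.
move=> eps0 sK prK.
pose T0 := [set x : F | `[< (pr @` K) x >]]%SET.
have T0P : proper_nonempty T0.
  apply/andP; split.
    apply/card_gt0P; exists 1%g; rewrite inE; apply/asboolP.
    by exists 1%g; [exact: is_subgroup1|exact: multiplicative1].
  rewrite ltnNge; apply/negP => leFT; apply: prK; apply/seteqP; split=> // x _.
  have /eqP T0T : T0 == [set: F]%SET by rewrite eqEcard finset.subsetT cardsT.
  by have := finset.in_setT x; rewrite -T0T inE => /asboolP.
apply: (@fixed_vertex_contracting_map _ _ _ translate1 translateM
          _ _ _ _ _ (Sub T0 T0P)) => // [T|d Kd]; first exact: stabiliser_nonsurj.
apply: val_inj; apply/finset.setP => x /=; rewrite mem_lcoset !inE.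
apply/asboolP/asboolP => -[k Kk kE].
  exists (d * k)%g; first exact: is_subgroupM.
  by rewrite gmulfM kE mulKVg.
exists (d^-1 * k)%g; last by rewrite gmulfM kE multiplicativeV.
by apply: is_subgroupM => //; exact: is_subgroupV.
Qed.

End NonSurjective.

(** * Depth, Dress groups, small functionals, finite quotients *)

Section Depth.
Local Open Scope nat_scope.

Lemma prime_dvd_bigprod p (ps : seq nat) : prime p -> all prime ps ->
  p %| \prod_(q <- ps) q -> p \in ps.
Proof.
move=> pr_p; elim: ps => [|q ps IH] /=; first by rewrite big_nil Euclid_dvd1.
rewrite big_cons Euclid_dvdM // => /andP[pr_q /IH{}IH].
by rewrite in_cons dvdn_prime2 // => /orP[->//|/IH->]; rewrite orbT.
Qed.

Lemma prime_factorisation n : 0 < n ->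
  exists2 ps : seq nat, all prime ps & \prod_(p <- ps) p = n.
Proof.
elim/ltn_ind: n => -[//|[|n]] IH _; first by exists [::]; rewrite ?big_nil.
have pr_p := pdiv_prime (isT : 1 < n.+2).
have [||ps all_ps psE] := IH (n.+2 %/ pdiv n.+2).
- by apply: ltn_Pdiv => //; exact: prime_gt1.
- by rewrite divn_gt0 ?pdiv_gt0 ?pdiv_leq.
exists (pdiv n.+2 :: ps); first by rewrite /= pr_p.
by rewrite big_cons psE mulnC divnK ?pdiv_dvd.
Qed.

(** Each proper inclusion in the chain uses up a prime of the list, namely one
that divides the index. *)
Lemma chain_length (Q : finGroupType) (t : seq {group Q}) (H : {group Q}) ps :
  path (fun H K : {group Q} => K \proper H) H t -> all prime ps ->
  #|H| %| \prod_(p <- ps) p -> size t <= size ps.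
Proof.
elim: t H ps => [//|K t IH] H ps /= /andP[ltKH Kt] all_ps Hps.
have sKH := proper_sub ltKH.
have idx_gt1 : 1 < #|H : K|%g by rewrite indexg_gt1; case/andP: ltKH.
have pr_p := pdiv_prime idx_gt1; set p := pdiv _ in pr_p.
have pK_H : #|K| * p %| #|H| by rewrite -(Lagrange sKH) dvdn_pmul2l ?pdiv_dvd.
have ps_p : p \in ps.
  apply: prime_dvd_bigprod => //; apply: dvdn_trans Hps.
  exact: dvdn_trans (dvdn_mull _ _) pK_H.
have K_rem : #|K| %| \prod_(q <- rem p ps) q.
  rewrite -(dvdn_pmul2r (prime_gt0 pr_p)) (dvdn_trans pK_H) //.
  by rewrite (dvdn_trans Hps) // (perm_big _ (perm_to_rem ps_p)) big_cons mulnC.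
have all_rem : all prime (rem p ps).
  by apply/allP => q /mem_rem; exact: (allP all_ps).
have := IH _ _ Kt all_rem K_rem; rewrite size_rem //.
by case: ps ps_p {all_ps Hps K_rem all_rem}.
Qed.

Lemma depth_bound (Q : finGroupType) ps : all prime ps ->
  #|Q| %| \prod_(p <- ps) p -> depth Q <= (size ps).+1.
Proof.
move=> all_ps Qps; apply/bigmax_leqP => n /existsP[s].
rewrite /subgroup_chain -[X in X <= _](size_tuple s).
case: (tval s) => [//|H t] /= Ht; rewrite ltnS.
apply: chain_length Ht all_ps _; apply: dvdn_trans Qps.
by rewrite -cardsT; apply: cardSg; exact: finset.subsetT.
Qed.

End Depth.

Section DressGroups.
Local Open Scope group_scope.

(** An [r]-subgroup has trivial image in the [q]-group [D / H] and meets the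
[p]-group [P] trivially, so that it embeds into the cyclic group [H / P]. *)
Lemma dress_cyclic (Q : finGroupType) (D : {group Q}) : dress D ->
  exists p q : nat, forall (r : nat) (R : {group Q}), r != p -> r != q ->
    prime r -> R \subset D -> r.-group R -> cyclic R.
Proof.
move=> [p [q [P [H [[pr_p pr_q] [nPH nHD] pP cycHP qDH]]]]].
exists p, q => r R rp rq pr_r RD rR.
have RH : R \subset H.
  have nHR : R \subset 'N(H)%g := fintype.subset_trans RD (normal_norm nHD).
  rewrite -quotient_sub1 //; apply/fintype.subsetP => x Rx.
  rewrite -(coprime_TIg (_ : coprime #|R / H| #|D / H|)%g).
    by rewrite inE Rx (fintype.subsetP (quotientS H RD)).
  apply: pnat_coprime (quotient_pgroup _ rR) _.
  by apply: sub_in_pnat qDH => s _ /eqP->; rewrite !inE eq_sym.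
have nPR : R \subset 'N(P)%g := fintype.subset_trans RH (normal_norm nPH).
have tiPR : (P :&: R = 1)%g.
  rewrite coprime_TIg // coprime_sym; apply: pnat_coprime rR _.
  by apply: sub_in_pnat pP => s _ /eqP->; rewrite !inE eq_sym.
rewrite (isog_cyclic (quotient_isog nPR tiPR)).
exact: cyclicS (quotientS P RH) cycHP.
Qed.

(** In an abelian group the elements of order [r] lie in the Sylow [r]-subgroup. *)
Lemma dress_torsion (Q : finGroupType) (D : {group Q}) : dress D ->
  exists p q : nat, forall (r : nat) (K : {group Q}), r != p -> r != q ->
    prime r -> K \subset D -> abelian K ->
    exists2 w, w \in K & forall x, x \in K -> (x ^+ r = 1)%g ->
      exists k, x = (w ^+ k)%g.
Proof.
move=> /dress_cyclic[p [q cycD]]; exists p, q => r K rp rq pr_r KD abK.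
have [R sylR] := Sylow_exists r K.
have [RK rR _] := and3P sylR.
have /cyclicP[w RE] := cycD r R rp rq pr_r (fintype.subset_trans RK KD) rR.
exists w => [|x Kx xr].
  by rewrite (fintype.subsetP RK) // RE cycle_id.
have : x \in R.
  rewrite (mem_normal_Hall sylR) -?sub_abelian_normal //.
  have xr' : (#[x] %| r)%N by rewrite order_dvdn xr.
  by apply: pnat_dvd xr' _; exact: pnat_id.
by rewrite RE => /cycleP.
Qed.

End DressGroups.

Lemma residue_subproof (n : nat) (z : int) : (0 < n)%N -> (`|(z %% n%:Z)%Z| < n)%N.
Proof.
move=> n_gt0; have := ltz_pmod z (_ : 0 < n%:Z); have := modz_ge0 z (_ : n%:Z != 0).
lia.
Qed.

Definition residue (n : nat) (n_gt0 : (0 < n)%N) (z : int) : 'I_n :=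
  Ordinal (residue_subproof z n_gt0).

Lemma residueP n (n_gt0 : (0 < n)%N) x y :
  residue n_gt0 x = residue n_gt0 y <-> (n%:Z %| x - y)%Z.
Proof.
rewrite -eqz_mod_dvd; have n0 : n%:Z != 0 by lia.
split=> [[e]|/eqP e]; last by apply: val_inj; rewrite /= e.
by apply/eqP; rewrite -[LHS]gez0_abs ?modz_ge0 // e gez0_abs ?modz_ge0.
Qed.

Lemma residue_nat n (n_gt0 : (0 < n)%N) (i : 'I_n) : residue n_gt0 i = i.
Proof. by apply: val_inj; rewrite /= modz_nat modn_small. Qed.

(** Pigeonhole: there are more than [r] pairs of coefficients in [0, k], so that two
of them give the same residue, and their difference works. *)
Lemma thue (r k : nat) (x y : int) : (0 < r)%N -> (r < k.+1 ^ 2)%N ->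
  exists a b : int, [/\ (a != 0) || (b != 0), `|a| <= k%:Z, `|b| <= k%:Z
                      & (r%:Z %| a * x + b * y)%Z].
Proof.
move=> r_gt0 lt_r.
pose h (ij : 'I_k.+1 * 'I_k.+1) := residue r_gt0 (ij.1%:Z * x + ij.2%:Z * y).
have : ~~ injectiveb h.
  apply/negP => /injectiveP /leq_card.
  by rewrite card_prod !card_ord leqNgt mulnn lt_r.
move=> /injectivePn[[i j] [[i' j'] neq /residueP /= hE]].
exists (i%:Z - i'%:Z), (j%:Z - j'%:Z).
have := ltn_ord i; have := ltn_ord i'; have := ltn_ord j; have := ltn_ord j'.
split; try lia.
  apply: contraNT neq; rewrite negb_or !negbK => /andP[ii jj].
  by apply/eqP; congr (_, _); apply: val_inj => /=; lia.
rewrite (_ : (i%:Z - i'%:Z) * x + (j%:Z - j'%:Z) * y = i%:Z * x + j%:Z * y -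
  (i'%:Z * x + j'%:Z * y)) //; ring.
Qed.

Lemma Euclid_dvdz (r : nat) (x y : int) : prime r ->
  (r%:Z %| x * y)%Z = (r%:Z %| x)%Z || (r%:Z %| y)%Z.
Proof. by move=> pr_r; rewrite !dvdzE abszM Euclid_dvdM. Qed.

(** The quotient of a group by a normal subgroup, as a group structure on a finite
type that classifies the cosets. *)
Section QuotientTransfer.
Variables (G : groupType) (T : finType) (N : set G) (p : G -> T).
Hypothesis N_normal : is_normal N.
Hypothesis N_subgroup : is_subgroup N.
Hypothesis pP : forall x y, p x = p y <-> N (x * y^-1)%g.
Hypothesis p_surj : forall t, exists x, p x = t.

Definition lift_class (t : T) : G := projT1 (cid (p_surj t)).

Lemma lift_classK : cancel lift_class p.
Proof. by move=> t; rewrite /lift_class; case: cid. Qed.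

Definition class_mul s t := p (lift_class s * lift_class t)%g.
Definition class_inv s := p (lift_class s)^-1%g.
Definition class_one := p 1%g.

Lemma class_congr x x' y y' :
  p x = p x' -> p y = p y' -> p (x * y)%g = p (x' * y')%g.
Proof.
move=> /pP xx' /pP yy'; apply/pP.
have -> : (x * y * (x' * y')^-1 = (y * y'^-1) ^ (x^-1) * (x * x'^-1))%g.
  by rewrite /conjg invgK !invgM !mulgA mulgVK.
by apply: is_subgroupM => //; exact: N_normal.
Qed.

Lemma class_mulE x y : class_mul (p x) (p y) = p (x * y)%g.
Proof. by apply: class_congr; rewrite lift_classK. Qed.

Lemma class_mulA : associative class_mul.
Proof.
move=> a b d; rewrite -[a]lift_classK -[b]lift_classK -[d]lift_classK.
by rewrite !class_mulE mulgA.
Qed.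

Lemma class_mul1 : left_id class_one class_mul.
Proof. by move=> a; rewrite -[a]lift_classK class_mulE mul1g. Qed.

Lemma class_mulV : left_inverse class_one class_inv class_mul.
Proof.
move=> a; rewrite -{2}[a]lift_classK class_mulE /class_one.
by rewrite mulVg.
Qed.

Definition class_group : Type := T.
HB.instance Definition _ := Finite.on class_group.
HB.instance Definition _ :=
  Finite_isGroup.Build class_group class_mulA class_mul1 class_mulV.

Definition class_proj (x : G) : class_group := p x.
Lemma class_projM : {morph class_proj : x y / (x * y)%g}.
Proof. by move=> x y; rewrite -[LHS]class_mulE. Qed.
HB.instance Definition _ :=
  isMultiplicative.Build G class_group class_proj class_projM.

Lemma finite_quotient : exists (Q : finGroupType) (pi : {multiplicative G -> Q}),
  [/\ range pi = setT, #|Q| = #|T| & forall x y, pi x = pi y <-> N (x * y^-1)%g].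
Proof.
exists class_group, class_proj; split=> //; last first.
  by apply: (@bij_eq_card _ _ (fun t : class_group => (t : T))); exists id.
apply/seteqP; split=> // t _.
by have [x xt] := p_surj t; exists x.
Qed.

End QuotientTransfer.

(** * Extending a lattice functional to an action on the line *)

Notation plane := 'rV[int]_2.

Definition functional (a b : int) (u : plane) : int := a * u 0 0 + b * u 0 1.

Lemma functionalD a b u v :
  functional a b (u + v) = functional a b u + functional a b v.
Proof. by rewrite /functional !mxE; ring. Qed.

Lemma functional_scale a b (k : int) u :
  functional a b (k *: u) = k * functional a b u.
Proof. by rewrite /functional !mxE; ring. Qed.

Lemma functional_bound (k : nat) a b u : `|a| <= k%:Z -> `|b| <= k%:Z ->
  `|functional a b u| <= k%:Z * (`|u 0 0| + `|u 0 1|).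
Proof.
move=> ak bk; rewrite mulrDr; apply: le_trans (ler_normD _ _) _.
by rewrite !normrM lerD // ler_wpM2r.
Qed.

(** After division of [(a, b)] by its gcd, a Bezout relation gives the coefficient
of [u] on [(b, - a)]. *)
Lemma functional_ker (a b : int) : (a != 0) || (b != 0) ->
  exists w : plane, functional a b w = 0 /\
    forall u, functional a b u = 0 -> exists k : int, u = k *: w.
Proof.
move=> ab0; pose d := gcdz a b.
have d0 : d != 0 by rewrite gcdz_eq0 negb_and.
have /dvdzP[a' aE] := dvdz_gcdl a b; have /dvdzP[b' bE] := dvdz_gcdr a b.
have [x [y xyE]] := Bezoutz a b.
have xy1 : x * a' + y * b' = 1.
  apply: (mulIf d0); rewrite mul1r -[RHS]xyE.
  by rewrite [in RHS]aE [X in _ = _ + _ * X]bE -/d; ring.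
pose w : plane := \row_j (if j == 0 then b' else - a').
have fE (u : plane) : functional a b u = d * (a' * u 0 0 + b' * u 0 1).
  by rewrite /functional {1}aE -/d {1}bE -/d; ring.
exists w; split; first by rewrite fE !mxE /=; ring.
move=> u; rewrite fE => /eqP; rewrite mulf_eq0 (negPf d0) /= => /eqP u0.
exists (y * u 0 0 - x * u 0 1); apply/rowP => j; rewrite !mxE.
case: (unliftP 0 j) => [j'|] ->; last first.
  transitivity ((x * a' + y * b') * u 0 0 - x * (a' * u 0 0 + b' * u 0 1)).
    by rewrite xy1 u0; ring.
  by rewrite /=; ring.
rewrite ord1 (_ : lift 0 0 = 1); last exact: val_inj.
transitivity ((x * a' + y * b') * u 0 1 - y * (a' * u 0 0 + b' * u 0 1)).
  by rewrite xy1 u0; ring.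
by rewrite /=; ring.
Qed.

(** In this section [emb] is an isomorphism of the lattice [plane] onto the kernel
of [pr], on which [G] acts by conjugation. *)
Section CrystallographicPlane.
Variables (G : groupType) (F : finGroupType) (pr : {multiplicative G -> F}).
Variable emb : plane -> G.
Hypothesis embD : forall u v, emb (u + v) = (emb u * emb v)%g.
Hypothesis emb_inj : injective emb.
Hypothesis embP : forall g, pr g = 1%g <-> exists u, emb u = g.
Hypothesis pr_surj : range pr = setT.

Definition plane_coord (g : G) : plane :=
  if pselect (exists u, emb u = g) is left ex then projT1 (cid ex) else 0.

Lemma plane_coordK g : pr g = 1%g -> emb (plane_coord g) = g.
Proof.
move=> /embP ex; rewrite /plane_coord; case: pselect => // ex'.
by case: cid.
Qed.

Lemma pr_emb u : pr (emb u) = 1%g. Proof. by apply/embP; exists u. Qed.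

Lemma embK u : plane_coord (emb u) = u.
Proof. by apply: emb_inj; rewrite plane_coordK // pr_emb. Qed.

Lemma plane_coordM g h : pr g = 1%g -> pr h = 1%g ->
  plane_coord (g * h)%g = plane_coord g + plane_coord h.
Proof.
move=> g1 h1; apply: emb_inj.
by rewrite embD !plane_coordK // gmulfM g1 h1 mulg1.
Qed.

Lemma emb0 : emb 0 = 1%g.
Proof. by apply: (@mulgI _ (emb 0)); rewrite -embD addr0 mulg1. Qed.

Lemma embN u : emb (- u) = (emb u)^-1%g.
Proof. by apply/esym/mulg1_eq; rewrite -embD addrN emb0. Qed.

Lemma emb_scale (k : nat) u : emb (u *+ k) = (emb u ^+ k)%g.
Proof.
by elim: k => [|k IH]; rewrite ?mulr0n ?emb0 ?expg0 // mulrS embD IH expgS.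
Qed.

Definition conj_plane (g : G) (u : plane) : plane :=
  plane_coord (g * emb u * g^-1)%g.

Lemma pr_conj g a : pr a = 1%g -> pr (g * a * g^-1)%g = 1%g.
Proof. by move=> a1; rewrite !gmulfM multiplicativeV a1 mulg1 mulgV. Qed.

Lemma emb_conj g u : emb (conj_plane g u) = (g * emb u * g^-1)%g.
Proof. by rewrite plane_coordK // pr_conj // pr_emb. Qed.

Lemma conjD g u v : conj_plane g (u + v) = conj_plane g u + conj_plane g v.
Proof.
by apply: emb_inj; rewrite embD !emb_conj embD !mulgA mulgVK.
Qed.

Lemma conjM g h u : conj_plane (g * h)%g u = conj_plane g (conj_plane h u).
Proof. by apply: emb_inj; rewrite !emb_conj invgM !mulgA. Qed.

Lemma conj_ker a u : pr a = 1%g -> conj_plane a u = u.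
Proof.
move=> /embP[v <-]; apply: emb_inj.
by rewrite emb_conj -embN -!embD addrC addKr.
Qed.

Lemma conj_pr g h u : pr g = pr h -> conj_plane g u = conj_plane h u.
Proof.
move=> gh; rewrite -[g](mulKVg h) conjM [conj_plane (h^-1 * g)%g u]conj_ker //.
by rewrite gmulfM multiplicativeV gh mulVg.
Qed.

Lemma conj1 u : conj_plane 1%g u = u.
Proof. by rewrite conj_ker // multiplicative1. Qed.

Lemma conjK g : cancel (conj_plane g) (conj_plane g^-1%g).
Proof. by move=> u; rewrite -conjM mulVg conj1. Qed.

Lemma conj_scale g (k : int) u : conj_plane g (k *: u) = k *: conj_plane g u.
Proof.
have conj0 : conj_plane g 0 = 0.
  by apply: (addrI (conj_plane g 0)); rewrite -conjD !addr0.
have conjN v : conj_plane g (- v) = - conj_plane g v.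
  by apply/eqP; rewrite -addr_eq0 -conjD addNr conj0.
have conjn v n : conj_plane g (v *+ n) = conj_plane g v *+ n.
  by elim: n => [|n IH]; rewrite ?mulr0n // !mulrS conjD IH.
by case: k => n; rewrite ?NegzE ?scaleNr -natz !scaler_nat ?conjN conjn.
Qed.

(** The determinant of two vectors. *)
Definition cross (u v : plane) : int := u 0 0 * v 0 1 - u 0 1 * v 0 0.

Definition e0 : plane := delta_mx 0 0.
Definition e1 : plane := delta_mx 0 1.

Lemma plane_coords (u : plane) : u = u 0 0 *: e0 + u 0 1 *: e1.
Proof.
apply/rowP => j; rewrite !mxE /=.
case: (unliftP 0 j) => [j'|] -> /=; last by rewrite mulr1 mulr0 addr0.
by rewrite ord1 (_ : lift 0 0 = 1) /= ?mulr0 ?mulr1 ?add0r //; exact: val_inj.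
Qed.

(** The scalar is the determinant of the conjugation action.  It is invertible,
as the inverse element acts by the inverse matrix. *)
Lemma conj_cross g :
  exists2 d : int, d * d = 1 &
    forall u v, cross (conj_plane g u) (conj_plane g v) = d * cross u v.
Proof.
pose d h := cross (conj_plane h e0) (conj_plane h e1).
have dP h u v : cross (conj_plane h u) (conj_plane h v) = d h * cross u v.
  rewrite [in LHS](plane_coords u) [in LHS](plane_coords v) !conjD !conj_scale.
  by rewrite /d /cross !mxE; ring.
have dd : d g * d g^-1%g = 1.
  rewrite mulrC -dP !conjK /cross !mxE /=; ring.
exists (d g) => [|//]; move: dd.
move: (d g) (d g^-1%g) => x y /(congr1 absz); rewrite abszM => /eqP.
by rewrite muln_eq1 => /andP[/eqP x1 _]; nia.
Qed.

(** A nonzero functional that is equivariant for the signs [chi]; it forces [chi] to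
be a character that is trivial on the lattice. *)
Section Cocycle.
Variables (a b : int) (chi : G -> int).
Hypothesis ab0 : (a != 0) || (b != 0).
Hypothesis chi_sq : forall g, chi g * chi g = 1.
Hypothesis equi :
  forall g u, functional a b (conj_plane g u) = chi g * functional a b u.

Lemma functional_neq0 : exists u, functional a b u != 0.
Proof.
case/orP: ab0 => x0; [exists e0|exists e1]; rewrite /functional !mxE /=.
  by rewrite mulr1 mulr0 addr0.
by rewrite mulr0 mulr1 add0r.
Qed.

Lemma chiM g h : chi (g * h)%g = chi g * chi h.
Proof.
have [u u0] := functional_neq0; apply: (mulIf u0).
by rewrite -equi conjM !equi mulrA.
Qed.

Lemma chi_ker g : pr g = 1%g -> chi g = 1.
Proof.
have [u u0] := functional_neq0 => g1; apply: (mulIf u0).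
by rewrite -equi conj_ker // mul1r.
Qed.

Lemma chi_pr g h : pr g = pr h -> chi g = chi h.
Proof.
move=> gh; rewrite -[g](mulgVK h) chiM chi_ker ?mul1r //.
by rewrite gmulfM multiplicativeV gh mulgV.
Qed.

Definition height (g : G) : int := functional a b (plane_coord g).

Lemma heightM g h : pr g = 1%g -> pr h = 1%g ->
  height (g * h)%g = height g + height h.
Proof. by move=> g1 h1; rewrite /height plane_coordM // functionalD. Qed.

Lemma height_conj g h : pr h = 1%g -> height (g * h * g^-1)%g = chi g * height h.
Proof. by move=> h1; rewrite /height -equi /conj_plane plane_coordK. Qed.

Lemma sectP (x : F) : exists g, pr g = x.
Proof. by have [g _ <-] : range pr x; [rewrite pr_surj|exists g]. Qed.

Definition sect (x : F) : G := projT1 (cid (sectP x)).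

Lemma sectK x : pr (sect x) = x.
Proof. by rewrite /sect; case: cid. Qed.

(** How far left multiplication by [g] is from permuting the chosen
representatives; it lies in the lattice. *)
Definition deviation (g : G) (x : F) : G :=
  ((sect (pr g * x))^-1 * (g * sect x))%g.

Lemma pr_deviation g x : pr (deviation g x) = 1%g.
Proof. by rewrite !gmulfM multiplicativeV !sectK mulVg. Qed.

Lemma deviationM g h x :
  deviation (g * h)%g x = (deviation g (pr h * x) * deviation h x)%g.
Proof. by rewrite /deviation gmulfM !mulgA !(mulgK, mulgVK). Qed.

(** Averaging the height of the deviations over [F] extends the functional.  The sum
is kept in place of the mean, so that the values are integers, and the factor 2
makes them even. *)
Definition cocycle (g : G) : int :=
  2 * (chi g * \sum_(x : F) chi (sect x) * height (deviation g x)).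

Lemma cocycleM g h : cocycle (g * h)%g = cocycle g + chi g * cocycle h.
Proof.
rewrite /cocycle chiM.
under eq_bigr do rewrite deviationM heightM ?pr_deviation // mulrDr.
rewrite big_split /= [X in _ + _ * (2 * (_ * X))]/=.
rewrite [X in 2 * (chi g * X) + _](reindex_inj (mulgI (pr h))) /=.
have -> : \sum_x chi (sect (pr h * x)%g) * height (deviation g (pr h * x)%g) =
    chi h * \sum_x chi (sect x) * height (deviation g (pr h * x)%g).
  rewrite mulr_sumr; apply: eq_bigr => x _; rewrite mulrA -chiM.
  by congr (_ * _); apply: chi_pr; rewrite gmulfM !sectK.
by ring.
Qed.

Lemma cocycle_ker g : pr g = 1%g -> cocycle g = 2 * #|F|%:Z * height g.
Proof.
move=> g1; rewrite /cocycle chi_ker // mul1r -mulrA; congr (2 * _).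
rewrite -natz mulr_natl -sumr_const.
under eq_bigr => x _.
  rewrite /deviation g1 mul1g mulgA -[X in height (_ * _ * X)](invgK (sect x)).
  rewrite height_conj // mulrA -chiM mulgV chi_ker ?multiplicative1 // mul1r.
  over.
by [].
Qed.



Lemma cocycle_even g : exists m : int, cocycle g = 2 * m.
Proof. by eexists. Qed.

(** The part of the bound for [cocycle g] that is the same for all functionals, to be
multiplied by the size of the coefficients. *)
Definition weight (g : G) : int :=
  2 * \sum_(x : F) (`|plane_coord (deviation g x) 0 0| +
                    `|plane_coord (deviation g x) 0 1|).

Lemma cocycle_bound (k : nat) g : `|a| <= k%:Z -> `|b| <= k%:Z ->
  `|cocycle g| <= k%:Z * weight g.
Proof.
move=> ak bk; have chi1 h : `|chi h| = 1 by have := chi_sq h; nia.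
rewrite /cocycle /weight !normrM chi1 mul1r mulrCA ler_wpM2l // mulr_sumr.
apply: le_trans (ler_norm_sum _ _ _) _; apply: ler_sum => x _.
by rewrite normrM chi1 mul1r; exact: functional_bound.
Qed.

Lemma emb_in_cycle (k : int) u : Defs.generated [set emb u] (emb (k *: u)).
Proof.
have sC := generated_subgroup [set emb u].
have Cu : Defs.generated [set emb u] (emb u) by exact: sub_generated.
case: k => n; rewrite ?NegzE ?scaleNr -natz scaler_nat ?embN emb_scale.
  exact: is_subgroupX n sC Cu.
exact: is_subgroupV sC (is_subgroupX n.+1 sC Cu).
Qed.

(** The kernel of the functional is cyclic, and it has finite index in the
stabiliser because cosets are told apart by their image in [F]. *)
Lemma stabiliser_virtually_cyclic v :
  virtually_cyclic [set g | line_act chi cocycle g v = v].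
Proof.
set Stab := [set g | _].
have sS : is_subgroup Stab by exact: line_stabiliser_subgroup chi_sq chiM cocycleM v.
have Stab_ker g : pr g = 1%g -> Stab g <-> height g = 0.
  move=> g1; rewrite /Stab /= /line_act chi_ker // cocycle_ker // mul1r.
  have F0 : (0 < #|F|)%N by apply/card_gt0P; exists 1%g.
  have nz : 2 * #|F|%:Z != 0 by lia.
  split=> [/eqP|->]; last by rewrite mulr0 addr0.
  by rewrite -subr_eq0 addrAC subrr add0r mulf_eq0 (negPf nz) /= => /eqP.
have [w [w0 wP]] := functional_ker ab0.
pose C := Defs.generated [set emb w].
have sC : is_subgroup C := generated_subgroup _.
have C_ker : C `<=` [set g | pr g = 1%g].
  apply: generated_sub => [|_ ->]; last exact: pr_emb.
  apply/is_subgroupP; split=> [|g h /= g1 h1]; first exact: multiplicative1.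
  by rewrite gmulfM multiplicativeV g1 h1 mulgV.
have CS : C `<=` Stab.
  apply: generated_sub => // _ ->.
  by apply/Stab_ker; [exact: pr_emb|rewrite /height embK].
exists C; split=> //; first by exists (emb w).
apply: (@sub_finite_set _ _
  ((fun x : F => [set g | Stab g /\ pr g = x]) @` setT)); last first.
  exact/finite_image/finite_finset.
move=> _ [x Sx <-]; exists (pr x) => //; apply/seteqP; split.
  move=> g [Sg gx]; exists (x^-1 * g)%g; last by rewrite mulKVg.
  have g1 : pr (x^-1 * g)%g = 1%g by rewrite gmulfM multiplicativeV gx mulVg.
  have /(Stab_ker _ g1)/wP[k kE] : Stab (x^-1 * g)%g.
    by apply: is_subgroupM => //; exact: is_subgroupV.
  by rewrite -(plane_coordK g1) kE; exact: emb_in_cycle.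
move=> _ [k Ck <-]; split; first by apply: is_subgroupM => //; exact: CS.
by rewrite gmulfM (C_ker k Ck) mulg1.
Qed.

(** Modulo [r] the restriction of the cocycle to [K] depends only on the image in
[F], so that [F] acts on [Z/r] by affine maps.  As its order is invertible modulo
[r], the mean of the orbit of 0 is a fixed point. *)
Lemma invariant_progression (r : nat) (K : set G) :
  coprime #|F| r -> is_subgroup K -> pr @` K = setT ->
  (forall g, K g -> pr g = 1%g -> (r%:Z %| height g)%Z) ->
  exists v0, forall d, K d -> (r%:Z %| line_act chi cocycle d v0 - v0)%Z.
Proof.
move=> co sK prK Kr.
have /choice[t tP] x : exists g, K g /\ pr g = x.
  by have [g Kg <-] : (pr @` K) x; [rewrite prK|exists g].
have [w [y wyE]] := Bezoutz #|F|%:Z r%:Z.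
have {}wyE : w * #|F|%:Z + y * r%:Z = 1.
  by rewrite wyE /gcdz /= (eqP co).
pose s := \sum_x cocycle (t x); exists (w * s) => d Kd.
have sd : \sum_x cocycle (d * t x)%g = #|F|%:Z * cocycle d + chi d * s.
  under eq_bigr do rewrite cocycleM.
  by rewrite big_split /= sumr_const -mulr_sumr -mulr_natl natz.
have [m mE] : exists m, \sum_x cocycle (d * t x)%g - s = m * r%:Z.
  apply/dvdzP; rewrite /s [X in _ - X](reindex_inj (mulgI (pr d))) /= -sumrB.
  apply: rpred_sum => x _.
  have [Kx xE] := tP x; have [Kdx dxE] := tP (pr d * x)%g.
  set k := ((t (pr d * x))^-1 * (d * t x))%g.
  (* [k] corrects [d * t x] to the chosen representative of its class in [F]. *)
  have k1 : pr k = 1%g by rewrite !gmulfM multiplicativeV xE dxE mulVg.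
  have Kk : K k.
    by apply: is_subgroupM; [|exact: is_subgroupV|exact: is_subgroupM].
  have -> : (d * t x = t (pr d * x) * k)%g by rewrite mulKVg.
  rewrite cocycleM addrC addKr cocycle_ker //.
  by apply: dvdz_mull; apply: dvdz_mull; exact: Kr.
rewrite sd in mE.
rewrite (_ : _ - _ = (w * m + y * cocycle d) * r%:Z) ?dvdz_mull //.
have {mE}-> : (w * m + y * cocycle d) * r%:Z =
   w * (#|F|%:Z * cocycle d + chi d * s - s) + (y * r%:Z) * cocycle d.
  by rewrite mE; ring.
have -> : y * r%:Z = 1 - w * #|F|%:Z by rewrite -wyE; ring.
by rewrite /line_act; ring.
Qed.

Lemma surj_contracting_map (R : realType) (S K : set G) (eps : R) (r k : nat) :
  odd r -> coprime #|F| r -> is_subgroup K -> pr @` K = setT ->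
  (forall g, K g -> pr g = 1%g -> (r%:Z %| height g)%Z) ->
  `|a| <= k%:Z -> `|b| <= k%:Z ->
  (forall s, S s -> (k%:Z * weight s)%:~R / r%:R *+ 4 <= eps) ->
  contracting_map S (vcyc_or_nonsurj_family pr) 1 K eps.
Proof.
move=> r_odd co sK prK Kr ak bk Seps.
have [v0 v0P] := invariant_progression co sK prK Kr.
apply: (line_contracting_map chi_sq chiM cocycleM cocycle_even r_odd _ v0P).
  move=> v; split; last by left; exact: stabiliser_virtually_cyclic.
  exact: line_stabiliser_subgroup chi_sq chiM cocycleM v.
move=> s /Seps; apply: le_trans; rewrite lerMn2r /= ler_pM2r; last first.
  by rewrite invr_gt0 ltr0n; case: r r_odd {co Kr Seps v0P}.
by rewrite ler_int cocycle_bound.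
Qed.

End Cocycle.
End CrystallographicPlane.

(** * Eigenfunctionals of the point group *)

Section EigenFunctionals.
Variables (G : groupType) (F : finGroupType) (pr : {multiplicative G -> F}).
Variable emb : plane -> G.
Hypothesis embD : forall u v, emb (u + v) = (emb u * emb v)%g.
Hypothesis emb_inj : injective emb.
Hypothesis embP : forall g, pr g = 1%g <-> exists u, emb u = g.
Hypothesis pr_surj : range pr = setT.

Local Notation conjL := (conj_plane emb).
Local Notation coordL := (plane_coord emb).

Definition eigen_functional (a b : int) (chi : G -> int) : Prop :=
  [/\ (a != 0) || (b != 0), forall g, chi g * chi g = 1
    & forall g u, functional a b (conjL g u) = chi g * functional a b u].

Lemma scale_inj (u : plane) (x y : int) : u != 0 -> x *: u = y *: u -> x = y.
Proof.
move=> /rV0Pn[j uj] /rowP/(_ j); rewrite !mxE; exact: mulIf.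
Qed.

(** If [c] generates the cyclic subgroup, then [c ^+ #|F|] lies in the lattice and
every conjugate of it is one of its integral multiples.  The multiples for [g] and
for its inverse have product 1, so that they are signs. *)
Lemma infinite_normal_cyclic_eigenvector :
  (exists C : set G,
     [/\ is_subgroup C, is_normal C, is_cyclic C & infinite_set C]) ->
  exists (u : plane) (chi : G -> int),
    [/\ u != 0, forall g, chi g * chi g = 1 & forall g, conjL g u = chi g *: u].
Proof.
move=> [C [sC nC [c CE] infC]].
pose N := #|F|.
have cN : pr (c ^+ N)%g = 1%g.
  by rewrite multiplicativeX /N -cardsT; apply: expg_cardG; exact: finset.in_setT.
have N_gt0 : (0 < N)%N by apply/card_gt0P; exists 1%g.
pose u := coordL (c ^+ N)%g.
have uE : emb u = (c ^+ N)%g by exact: (plane_coordK embP).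
(* Otherwise the infinite cyclic subgroup would consist of powers below [N]. *)
have u0 : u != 0.
  apply/eqP => u0; apply: infC; move: uE; rewrite u0 (emb0 embD) => cN1.
  have modE k : (c ^+ k = c ^+ (k %% N))%g.
    by rewrite {1}(divn_eq k N) expgnDr mulnC expgnA -cN1 expg1n mul1g.
  apply: (@sub_finite_set _ _ ((fun i : 'I_N => (c ^+ i)%g) @` setT)).
    rewrite CE => x /cycle_generatedE[k [->|->]].
      by exists (Ordinal (ltn_pmod k N_gt0)) => //=; rewrite -modE.
    exists (Ordinal (ltn_pmod (k * N.-1) N_gt0)) => //=; rewrite -modE.
    apply/esym/mulg1_eq; rewrite -expgnDr -[X in (X + _)%N]muln1 -mulnDr add1n.
    by rewrite prednK // mulnC expgnA -cN1 expg1n.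
  exact/finite_image/finite_finset.
have eig g : exists j : int, conjL g u = j *: u.
  have Cc : C c by rewrite CE; exact: sub_generated.
  have := nC c g^-1%g Cc; rewrite CE => /cycle_generatedE[n cg].
  have gcg : emb (conjL g u) = ((c ^ g^-1) ^+ N)%g.
    by rewrite (emb_conj embP) uE -conjXg /conjg invgK mulgA.
  case: cg => cg; [exists n%:Z|exists (- n%:Z)]; apply: emb_inj.
    by rewrite gcg cg -expgnA mulnC expgnA -uE -(emb_scale embD) -natz scaler_nat.
  rewrite scaleNr (embN embD) -natz scaler_nat (emb_scale embD) uE gcg cg.
  by rewrite expVgn -!expgnA mulnC.
have [chi chiE] := choice eig; exists u, chi; split=> // g.
have : chi g * chi g^-1%g = 1.
  apply: (scale_inj u0); rewrite scale1r -[RHS](conjK embD emb_inj embP g^-1%g).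
  rewrite invgK [X in conj_plane _ _ X]chiE (conj_scale embD emb_inj embP).
  by rewrite [conj_plane _ _ _]chiE scalerA mulrC.
move: (chi g) (chi g^-1%g) => x y /(congr1 absz); rewrite abszM => /eqP.
by rewrite muln_eq1 => /andP[/eqP x1 _]; nia.
Qed.

Lemma cross_functional u v : cross u v = functional (- u 0 1) (u 0 0) v.
Proof. by rewrite /cross /functional; ring. Qed.

Lemma ord2P (l : 'I_2) : l = 0 \/ l = 1.
Proof.
by case: (unliftP 0 l) => [l'|] ->; [right; rewrite ord1; exact: val_inj|left].
Qed.

Lemma cross_eq0 u v j : cross u v = 0 -> u 0 j *: v = v 0 j *: u.
Proof.
rewrite /cross => /eqP; rewrite subr_eq0 => /eqP uv; apply/rowP => i; rewrite !mxE.
have [->|->] := ord2P i; have [->|->] := ord2P j; rewrite ?(mulrC (v _ _)) //.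
Qed.

(** The first functional is the [chi]-twisted average over [F] of the scalar product
with [u]; it is positive at [u].  The second one is the determinant against [u],
which [g] multiplies by [chi g] times its own determinant.  A vector killed by the
second is proportional to [u], hence it is 0 if the first kills it as well. *)
Lemma eigen_functionals (u : plane) (chi : G -> int) :
  u != 0 -> (forall g, chi g * chi g = 1) ->
  (forall g, conjL g u = chi g *: u) ->
  exists a1 b1 a2 b2 chi2,
    [/\ eigen_functional a1 b1 chi, eigen_functional a2 b2 chi2
      & forall w, functional a1 b1 w = 0 -> functional a2 b2 w = 0 -> w = 0].
Proof.
move=> u0 chi_sq uE.
have chiM g h : chi (g * h)%g = chi g * chi h.
  apply: (scale_inj u0); rewrite -uE [conjL _ _](conjM emb_inj embP) uE.
  by rewrite [conjL _ _](conj_scale embD emb_inj embP) uE scalerA mulrC.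
pose s := sect pr_surj; have sK : forall x, pr (s x) = x := sectK pr_surj.
pose a1 := \sum_x chi (s x) * functional (u 0 0) (u 0 1) (conjL (s x) e0).
pose b1 := \sum_x chi (s x) * functional (u 0 0) (u 0 1) (conjL (s x) e1).
have phiE v : functional a1 b1 v =
    \sum_x chi (s x) * functional (u 0 0) (u 0 1) (conjL (s x) v).
  rewrite /functional -/e0 /a1 /b1 !mulr_suml -big_split /=; apply: eq_bigr => x _.
  rewrite -/(functional _ _ _) [in RHS](plane_coords v).
  rewrite (conjD embD emb_inj embP) !(conj_scale embD emb_inj embP).
  by rewrite functionalD !functional_scale; ring.
(* As [u] is an eigenvector for [chi], every term of the average at [u] is the square
   of the length of [u]. *)
have phi_u : functional a1 b1 u != 0.
  rewrite phiE; under eq_bigr => x _.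
    rewrite uE functional_scale mulrA chi_sq mul1r; over.
  have [j uj] := rV0Pn _ u0.
  have F0 : (0 < #|F|)%N by apply/card_gt0P; exists 1%g.
  rewrite sumr_const -mulr_natl mulf_neq0 //; first by rewrite pnatr_eq0 -lt0n.
  rewrite /functional; apply: contra uj; rewrite -!expr2 paddr_eq0 ?sqr_ge0 //.
  rewrite !sqrf_eq0 => /andP[u00 u01].
  by have [->|->] := ord2P j.
have equi1 g v : functional a1 b1 (conjL g v) = chi g * functional a1 b1 v.
  rewrite !phiE mulr_sumr [RHS](reindex_inj (mulIg (pr g))) /=.
  apply: eq_bigr => x _.
  (* The signs and the conjugation action depend only on the image in [F], so that
     right translation by [g] permutes the terms of the average. *)
  have sE : pr (s (x * pr g)%g) = pr (s x * g)%g by rewrite gmulfM !sK.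
  have -> : chi (s (x * pr g)%g) = chi (s x) * chi g.
    rewrite -chiM; apply: (scale_inj u0).
    by rewrite -!uE; exact: (conj_pr embD emb_inj embP).
  rewrite (conj_pr embD emb_inj embP v sE) (conjM emb_inj embP).
  by rewrite [RHS]mulrA [chi g * _]mulrCA chi_sq mulr1.
have /choice[d dP] g : exists d : int, d * d = 1 /\ forall v w,
    cross (conjL g v) (conjL g w) = d * cross v w.
  by have [d d2 dP] := conj_cross embD emb_inj embP g; exists d.
exists a1, b1, (- u 0 1), (u 0 0), (fun g => chi g * d g); split.
- split=> //; apply: contraNT phi_u; rewrite negb_or !negbK => /andP[/eqP-> /eqP->].
  by rewrite /functional !mul0r.
- split.
  + have [j uj] := rV0Pn _ u0.
    by have [jE|jE] := ord2P j; rewrite jE in uj; rewrite ?oppr_eq0 uj ?orbT.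
  + by move=> g; rewrite mulrACA chi_sq (dP g).1 mulr1.
  move=> g v; rewrite -!cross_functional -mulrA -(dP g).2 uE.
  have -> z : cross (chi g *: u) z = chi g * cross u z.
    by rewrite /cross !mxE; ring.
  by rewrite mulrA chi_sq mul1r.
move=> w w1 w2; have {}w2 : cross u w = 0 by rewrite cross_functional.
apply/rowP => j; rewrite mxE; apply/eqP; move/eqP: (cross_eq0 j w2).
have := congr1 (functional a1 b1) (cross_eq0 j w2).
rewrite !functional_scale w1 mulr0 => /esym/eqP.
by rewrite mulf_eq0 (negPf phi_u) orbF.
Qed.

(** If the two characters agree, all of [G] acts on the lattice by signs and a small
functional that kills the line of [a0] modulo [r] is available.  Otherwise some [s]
in [K] has different signs; conjugation by [s] preserves the line, so that [s] acts
on it by one scalar modulo [r], which can match the sign of at most one of the two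
functionals. *)
Lemma dress_line_functional (r k : nat) (K : set G) (a0 : G) (m : int)
    a1 b1 a2 b2 chi1 chi2 :
  eigen_functional a1 b1 chi1 -> eigen_functional a2 b2 chi2 ->
  (forall w, functional a1 b1 w = 0 -> functional a2 b2 w = 0 -> w = 0) ->
  [/\ `|a1| <= k%:Z, `|b1| <= k%:Z, `|a2| <= k%:Z & `|b2| <= k%:Z] ->
  prime r -> odd r -> (r < k.+1 ^ 2)%N ->
  is_subgroup K -> pr @` K = setT ->
  K a0 -> pr a0 = 1%g -> ~~ (r%:Z %| m)%Z ->
  (forall g, K g -> pr g = 1%g -> exists (j : int) (v : plane),
     m *: coordL g - j *: coordL a0 = r%:Z *: v) ->
  exists a b chi, [/\ eigen_functional a b chi, `|a| <= k%:Z, `|b| <= k%:Z &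
    forall g, K g -> pr g = 1%g -> (r%:Z %| height emb a b g)%Z].
Proof.
move=> eig1 eig2 inj12 [a1k b1k a2k b2k] pr_r r_odd lt_r sK prK Ka0 a01 rm line.
have height_line a b g : K g -> pr g = 1%g ->
    exists j, (r%:Z %| m * height emb a b g - j * height emb a b a0)%Z.
  move=> Kg g1; have [j [v jv]] := line g Kg g1; exists j; apply/dvdzP.
  exists (functional a b v); rewrite [RHS]mulrC; have := congr1 (functional a b) jv.
  by rewrite functionalD -scaleNr !functional_scale mulNr.
have line_height a b : (r%:Z %| height emb a b a0)%Z ->
    forall g, K g -> pr g = 1%g -> (r%:Z %| height emb a b g)%Z.
  move=> ra0 g Kg g1; have [j jr] := height_line a b g Kg g1.
  have : (r%:Z %| m * height emb a b g)%Z.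
    by rewrite -(subrK (j * height emb a b a0) (m * _)) rpredD // [_ \in _]dvdz_mull.
  by rewrite Euclid_dvdz // (negPf rm).
have [chi12|/existsNP[t chi12]] := pselect (forall g, chi1 g = chi2 g).
  have [a [b [ab0 ak bk rab]]] :=
    thue (coordL a0 0 0) (coordL a0 0 1) (prime_gt0 pr_r) lt_r.
  exists a, b, chi1; split=> //; last exact: line_height.
  have [[_ sq1 e1] [_ _ e2]] := (eig1, eig2); split=> // g u.
  rewrite -functional_scale; congr functional; apply/eqP; rewrite -subr_eq0.
  apply/eqP; apply: inj12; rewrite functionalD -scaleNr functional_scale ?e1 ?e2.
    by rewrite mulNr addrN.
  by rewrite -chi12 mulNr addrN.
have [r1|r1] := boolP (r%:Z %| height emb a1 b1 a0)%Z.
  by exists a1, b1, chi1; split=> //; exact: line_height.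
exists a2, b2, chi2; split=> //; apply: line_height.
have [[ab1 sq1 e1] [ab2 sq2 e2]] := (eig1, eig2).
have [s Ks sE] : (pr @` K) (pr t) by rewrite prK.
have t1 : chi1 s = chi1 t by exact: (chi_pr embD emb_inj embP ab1 e1).
have t2 : chi2 s = chi2 t by exact: (chi_pr embD emb_inj embP ab2 e2).
have Ksa : K (s * a0 * s^-1)%g.
  by apply: is_subgroupM; [|exact: is_subgroupM|exact: is_subgroupV].
have sa1 := pr_conj s a01.
have [j [v jv]] := line _ Ksa sa1.
have hE a b chi : eigen_functional a b chi ->
    (r%:Z %| (m * chi s - j) * height emb a b a0)%Z.
  move=> [_ _ e]; apply/dvdzP; exists (functional a b v).
  rewrite [RHS]mulrC; have := congr1 (functional a b) jv.
  rewrite functionalD -scaleNr !functional_scale => <-.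
  by rewrite -!/(height emb a b _) (height_conj embP e) //; ring.
have := hE _ _ _ eig1; rewrite Euclid_dvdz // (negPf r1) orbF => h1.
have := hE _ _ _ eig2; rewrite Euclid_dvdz // => /orP[h2|//].
have : (r%:Z %| m * (chi1 s - chi2 s))%Z.
  have -> : m * (chi1 s - chi2 s) = (m * chi1 s - j) - (m * chi2 s - j) by ring.
  exact: rpredB.
rewrite Euclid_dvdz // (negPf rm) /= t1 t2 => r2.
have : (r%:Z %| 2%:Z)%Z.
  move: chi12 r2; have [->|->] := int_sqr_eq1 (sq1 t);
    have [->|->] := int_sqr_eq1 (sq2 t) => //.
rewrite dvdzE /= dvdn_prime2 // => /eqP r2E.
by move: r_odd; rewrite r2E.
Qed.

End EigenFunctionals.

(** * Congruence quotients *)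

Section CongruenceQuotient.
Variables (G : groupType) (F : finGroupType) (pr : {multiplicative G -> F}).
Variable emb : plane -> G.
Hypothesis embD : forall u v, emb (u + v) = (emb u * emb v)%g.
Hypothesis emb_inj : injective emb.
Hypothesis embP : forall g, pr g = 1%g <-> exists u, emb u = g.
Hypothesis pr_surj : range pr = setT.

Let t := sect pr_surj.

(** The lattice component of [g] relative to the chosen representatives of [F].  Its
residue modulo [n], with the image in [F], determines the coset of [g]. *)
Definition translation_part (g : G) : plane := plane_coord emb (g * (t (pr g))^-1)%g.

Lemma translation_partE g : emb (translation_part g) = (g * (t (pr g))^-1)%g.
Proof.
rewrite (plane_coordK embP) // gmulfM multiplicativeV.
by rewrite [pr (t _)]sectK mulgV.
Qed.

Lemma translation_part_diff x y : pr x = pr y ->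
  emb (translation_part x - translation_part y) = (x * y^-1)%g.
Proof.
move=> xy; rewrite embD (embN embD) !translation_partE xy.
by rewrite invgM invgK mulgA mulgVK.
Qed.

Lemma divisible_plane (n : nat) (u : plane) :
  (n%:Z %| u 0%R 0%R)%Z -> (n%:Z %| u 0%R 1%R)%Z -> exists v : plane, u = n%:Z *: v.
Proof.
move=> /dvdzP[a aE] /dvdzP[b bE].
exists (\row_j if j == 0 then a else b); apply/rowP => j; rewrite !mxE.
by have [->|->] := ord2P j; rewrite ?aE ?bE /= mulrC.
Qed.

Definition congruence_subgroup (n : nat) : set G :=
  [set g | exists v : plane, g = emb (n%:Z *: v)].

Lemma congruence_subgroup_subgroup n : is_subgroup (congruence_subgroup n).
Proof.
apply/is_subgroupP; split=> [|_ _ [u ->] [v ->]].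
  by exists 0; rewrite scaler0 (emb0 embD).
by exists (u - v); rewrite -(embN embD) -embD scalerBr.
Qed.

Lemma congruence_subgroup_normal n : is_normal (congruence_subgroup n).
Proof.
move=> _ g [v ->]; exists (conj_plane emb g^-1%g v).
rewrite -(conj_scale embD emb_inj embP) (emb_conj embP) /conjg invgK.
by rewrite mulgA.
Qed.

Lemma congruence_quotient (n : nat) : (0 < n)%N ->
  exists (Q : finGroupType) (pi : {multiplicative G -> Q}),
    [/\ range pi = setT, #|Q| = (n * n * #|F|)%N
      & forall x y, pi x = pi y <-> congruence_subgroup n (x * y^-1)%g].
Proof.
move=> n_gt0.
pose p g : 'I_n * 'I_n * F :=
  (residue n_gt0 (translation_part g 0 0),
   residue n_gt0 (translation_part g 0 1), pr g).
have pP x y : p x = p y <-> congruence_subgroup n (x * y^-1)%g.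
  split=> [e|[v vE]].
    have /residueP x0 := congr1 (fun z => z.1.1) e.
    have /residueP x1 := congr1 (fun z => z.1.2) e.
    have xy : pr x = pr y := congr1 snd e.
    have [||v vE] := @divisible_plane n (translation_part x - translation_part y).
    - by rewrite !mxE.
    - by rewrite !mxE.
    by exists v; rewrite -vE translation_part_diff.
  have xy : pr x = pr y.
    apply: (mulIg (pr y)^-1%g).
    by rewrite mulgV -multiplicativeV -gmulfM vE (pr_emb embP).
  have dE : translation_part x - translation_part y = n%:Z *: v.
    by apply: emb_inj; rewrite translation_part_diff.
  rewrite /p xy; congr (_, _, _); apply/residueP.
    by have /rowP/(_ 0) := dE; rewrite !mxE => ->; rewrite dvdz_mulr.
  by have /rowP/(_ 1) := dE; rewrite !mxE => ->; rewrite dvdz_mulr.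
have p_surj c : exists g, p g = c.
  case: c => -[i j] x.
  pose u : plane := \row_l if l == 0 then (i : nat)%:Z else (j : nat)%:Z.
  exists (emb u * t x)%g.
  have prE : pr (emb u * t x)%g = x.
    by rewrite gmulfM (pr_emb embP) mul1g [pr (t _)]sectK.
  have uE : translation_part (emb u * t x)%g = u.
    by apply: emb_inj; rewrite translation_partE prE mulgK.
  by rewrite /p prE uE !mxE /= !residue_nat.
have [Q [pi [piT cardQ piP]]] := finite_quotient (@congruence_subgroup_normal n)
  (@congruence_subgroup_subgroup n) pP p_surj.
by exists Q, pi; split=> //; rewrite cardQ !card_prod !card_ord.
Qed.

(** The elements [g ^+ (n %/ r)] have order dividing [r] in the quotient, and these
form a cyclic subgroup of the Dress group. *)
Lemma dress_preimage_line (n : nat) (Q : finGroupType)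
    (pi : {multiplicative G -> Q}) (D : {group Q}) :
  (forall x y, pi x = pi y <-> congruence_subgroup n (x * y^-1)%g) ->
  dress D ->
  exists p q : nat, forall r : nat, prime r -> r != p -> r != q -> (r %| n)%N ->
    exists a0, [/\ pi a0 \in D, pr a0 = 1%g &
      forall g, pi g \in D -> pr g = 1%g -> exists (j : int) (v : plane),
        (n %/ r)%N%:Z *: plane_coord emb g - j *: plane_coord emb a0 = r%:Z *: v].
Proof.
move=> piP /dress_torsion[p [q torsion]]; exists p, q => r pr_r rp rq r_n.
pose KA := [set x in D | `[< exists u, pi (emb u) = x >]]%SET.
have KAP x : reflect (x \in D /\ exists u, pi (emb u) = x) (x \in KA).
  by rewrite inE; apply: (iffP andP) => -[Dx /asboolP ex].
have gKA : group_set KA.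
  apply/group_setP; split=> [|x y /KAP[Dx [u ux]] /KAP[Dy [v vy]]]; apply/KAP.
    by split; [exact: group1|exists 0; rewrite (emb0 embD) multiplicative1].
  by split; [exact: groupM|exists (u + v); rewrite embD gmulfM ux vy].
have abKA : abelian (Group gKA).
  apply/centsP => x /KAP[_ [u <-]] y /KAP[_ [v <-]].
  by rewrite /commute -!gmulfM -!embD addrC.
have sKA : Group gKA \subset D by apply/fintype.subsetP => x /KAP[].
have [w /KAP[Dw [w0 w0E]] wP] := torsion r (Group gKA) rp rq pr_r sKA abKA.
exists (emb w0); split=> [||g Dg g1]; rewrite ?w0E ?(pr_emb embP) //.
have piX u k : pi (emb (u *+ k)) = (pi (emb u) ^+ k)%g.
  by rewrite (emb_scale embD) multiplicativeX.
set u := plane_coord emb g; have uE : emb u = g by exact: plane_coordK embP _ g1.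
have mKA : pi (emb (u *+ (n %/ r))) \in KA.
  apply/KAP; split; last by eexists.
  by rewrite piX uE groupX.
have mr : (pi (emb (u *+ (n %/ r))) ^+ r = 1)%g.
  rewrite -piX -mulrnA divnK // -(multiplicative1 pi); apply/piP.
  by exists u; rewrite invg1 mulg1 -natz scaler_nat.
have [k] := wP _ mKA mr; rewrite -w0E -piX => /piP[v].
rewrite -(embN embD) -embD => /emb_inj vE.
exists k%:Z, ((n %/ r)%N%:Z *: v).
rewrite (embK emb_inj embP) scalerA -PoszM mulnC divnK // -vE.
by rewrite -!natz !scaler_nat.
Qed.

End CongruenceQuotient.

(** * The contracting maps *)

Lemma nat_sqrt (r : nat) : exists k, (k ^ 2 <= r < k.+1 ^ 2)%N.
Proof.
elim: r => [|r [k /andP[lek ltk]]]; first by exists 0%N.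
have [lt|ge] := ltnP r.+1 (k.+1 ^ 2); first by exists k; rewrite lt leqW.
by exists k.+1; rewrite ge; apply: leq_ltn_trans ltk _; rewrite ltn_sqr.
Qed.

(** For any two primes [p] and [q], one of three distinct primes avoids both. *)
Lemma three_primes (m : nat) : exists r1 r2 r3 : nat,
  [/\ prime r1, prime r2 & prime r3] /\
  forall p q : nat, exists r, [/\ prime r, (m < r)%N, r != p, r != q &
    (r %| r1 * r2 * r3)%N && ~~ (r %| (r1 * r2 * r3) %/ r)%N].
Proof.
have [r1 m1 p1] := prime_above m; have [r2 m2 p2] := prime_above r1.
have [r3 m3 p3] := prime_above r2.
exists r1, r2, r3; split=> // p q.
have coprime_part r s : prime r -> (r %| s)%N = false ->
    (r %| r * s)%N && ~~ (r %| (r * s) %/ r)%N.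
  by move=> pr_r rs; rewrite dvdn_mulr // mulKn ?prime_gt0 // rs.
have [n1|n1] := boolP ((r1 != p) && (r1 != q)).
  have /andP[? ?] := n1; exists r1; split=> //; rewrite -mulnA.
  by apply: coprime_part => //; rewrite Euclid_dvdM // !dvdn_prime2 //; lia.
have [n2|n2] := boolP ((r2 != p) && (r2 != q)).
  have /andP[? ?] := n2; exists r2; split=> //; first by lia.
  rewrite mulnAC mulnC.
  by apply: coprime_part => //; rewrite Euclid_dvdM // !dvdn_prime2 //; lia.
exists r3; split=> //; try lia.
rewrite mulnC; apply: coprime_part => //.
by rewrite Euclid_dvdM // !dvdn_prime2 //; lia.
Qed.

Theorem proposition5p3 (R : realType) (Gamma : groupType) (A : set Gamma)
    (F : finGroupType) (pr : {multiplicative Gamma -> F})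
    (crystA : crystallographic_subgroup A 2)
    (normal_Z : exists C : set Gamma,
      [/\ is_subgroup C, is_normal C, is_cyclic C & infinite_set C])
    (pr_surj : range pr = setT)
    (ker_pr : pr @^-1` [set 1%g] = A)
    (S : set Gamma) (finS : finite_set S) (genS : symmetric_generating S) :
  dress_farrell_hsiang R S (vcyc_or_nonsurj_family pr).
Proof.
have [_ _ [emb [embD emb_inj embA]] _ _] := crystA.
have embP g : pr g = 1%g <-> exists u, emb u = g.
  split=> [g1|[u <-]].
    by have [u _ <-] : range emb g; [rewrite embA -ker_pr|exists u].
  have : A (emb u) by rewrite -embA; exists u.
  by rewrite -ker_pr.
have [u [chi1 [u0 chi1_sq uE]]] :=
  infinite_normal_cyclic_eigenvector embD emb_inj embP normal_Z.
have [a1 [b1 [a2 [b2 [chi2 [eig1 eig2 inj12]]]]]] :=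
  eigen_functionals embD emb_inj embP pr_surj u0 chi1_sq uE.
have /finite_seqP[s sE] := finS.
pose W := \max_(g <- s) `|weight emb pr_surj g|%N.
have leW g : S g -> weight emb pr_surj g <= W%:Z.
  rewrite sE /= => sg; have : (`|weight emb pr_surj g| <= W)%N.
    exact: leq_bigmax_seq.
  lia.
have F_gt0 : (0 < #|F|)%N by apply/card_gt0P; exists 1%g.
have [psF all_psF psFE] := prime_factorisation F_gt0.
exists 1%N, (size psF + 7)%N => eps eps_gt0.
(* With [r] close to [k ^ 2], the map below moves neighbours at most [4 k W / r] apart,
   which is at most [eps] once [k] exceeds the bound [4 W / eps]; the other terms make room for the
   coefficients of the two eigenfunctionals. *)
pose k0 := (`|a1| + `|b1| + `|a2| + `|b2| + Num.bound (W%:R * 4 / eps))%N.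
have [r1 [r2 [r3 [[p1 p2 p3] primesP]]]] := three_primes (#|F| + 2 + k0 ^ 2).
set n := (r1 * r2 * r3)%N in primesP.
have n_gt0 : (0 < n)%N by rewrite !muln_gt0 !prime_gt0.
have [Q [pi [piT cardQ piP]]] := congruence_quotient embD emb_inj embP pr_surj n_gt0.
exists Q, pi; split=> //.
  have := @depth_bound Q ([:: r1; r1; r2; r2; r3; r3] ++ psF).
  rewrite all_cat all_psF /= p1 p2 p3 => /(_ isT); rewrite addnC; apply.
  by rewrite cardQ !big_cons psFE /n (_ : (_ * _ * _)%N =
    (r1 * (r1 * (r2 * (r2 * (r3 * (r3 * #|F|))))))%N) //; ring.
move=> D dressD; pose K := [set g | pi g \in D].
have sK : is_subgroup K.
  apply/is_subgroupP; split=> [|x y Kx Ky]; rewrite /K /=.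
    by rewrite multiplicative1 group1.
  by rewrite gmulfM multiplicativeV groupM ?groupV.
rewrite -/(contracting_map S (vcyc_or_nonsurj_family pr) 1 K eps).
have [prK|prK] := pselect (pr @` K = setT); last exact: nonsurj_contracting_map.
have [p [q line]] := dress_preimage_line embD emb_inj embP piP dressD.
have [r [pr_r lt_r rp rq /andP[r_n r_nr]]] := primesP p q.
have [a0 [Ka0 a01 a0P]] := line r pr_r rp rq r_n.
have [k /andP[le_k lt_k]] := nat_sqrt r.
have lt_F : (#|F| < r)%N by apply: leq_ltn_trans lt_r; rewrite -addnA leq_addr.
have k0_k : (k0 <= k)%N.
  rewrite -ltnS -ltn_sqr; apply: ltn_trans lt_k.
  by apply: leq_ltn_trans lt_r; exact: leq_addl.
have r_odd : odd r.
  apply: contraTT lt_r => /(prime_oddPn pr_r)->.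
  by rewrite -leqNgt addnAC leq_addl.
have [|//|a [b [chi [[ab0 chi_sq equi] ak bk height_r]]]] :=
  dress_line_functional embD emb_inj embP eig1 eig2 inj12 _ pr_r r_odd lt_k
    sK prK Ka0 a01 (_ : ~~ (r%:Z %| (n %/ r)%N%:Z)%Z) a0P.
  by split; move: k0_k; rewrite /k0; clear; lia.
apply: (surj_contracting_map embD emb_inj embP ab0 chi_sq equi r_odd _ sK prK
          height_r ak bk).
  by rewrite coprime_sym prime_coprime // gtnNdvd.
move=> g Sg.
have k_large : W%:R * 4 <= eps * k%:R.
  rewrite [leRHS]mulrC -ler_pdivrMr //; apply: le_trans (ltW (archi_boundP _)) _.
    by rewrite divr_ge0 ?mulr_ge0 // ltW.
  by rewrite ler_nat (leq_trans _ k0_k) // leq_addl.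
have r_gt0 : 0 < r%:R :> R by rewrite ltr0n prime_gt0.
rewrite -mulr_natr mulrAC ler_pdivrMr //.
apply: (@le_trans _ _ (k%:R * (W%:R * 4))).
  rewrite mulrA ler_wpM2r // -natrM pmulrn ler_int PoszM ler_wpM2l //.
  exact: leW.
apply: le_trans (ler_wpM2l (ler0n _ _) k_large) _.
by rewrite mulrCA (ler_pM2l eps_gt0) -natrM ler_nat mulnn.
Qed.
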